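(* Let $(M,\omega)$ be a connected symplectic manifold with compatible almost complex structure $J$ such that the Maslov $S^1$ bundle $\Gamma_J^2\to M$ is trivial, and let $\Phi$ be a symplectic $S^1$ action on $M$ which has fixed points. Then the Maslov index $\mathfrak{m}_{\mathfrak{s}}(\Phi)$ of $\Phi$ does not depend on the choice of global section $\mathfrak{s}:M\to\Gamma_J^2$, and $\mathfrak{m}_{\mathfrak{s}}(\Phi)=k_p$, where $p\in M$ is any fixed point of $\Phi$ and $k_p$ is its local Maslov index.
   Context: Let $\dim M=2n$. $J$ is compatible with $\omega$ if $g_J(u,v)=\omega(Ju,v)$ is a Riemannian metric. A unitary frame of $T_pM$ is a basis $(u_1,\dots,u_n,v_1,\dots,v_n)$ with $v_i=-Ju_i$, $g_J(u_i,u_j)=\delta_{ij}$, $g_J(u_i,v_j)=0$. $\mathbb{U}(n)$ is identified with the real matrices $C=\begin{bmatrix} A & -B \\ B & A \end{bmatrix}$ with $A+iB$ unitary, acts on frames from the right, and $\det_{\mathbb C}C=\det(A+iB)$. $Fr^u_J\to M$ is the principal $\mathbb{U}(n)$-bundle of unitary frames, $\mathbb{EU}(n)=\{\det_{\mathbb C}=\pm1\}$, and $\pi_{\Gamma_J^2}:\Gamma_J^2=Fr^u_J/\mathbb{EU}(n)\to M$ is a principal $S^1$ bundle with inherent $S^1$ action $[f]\cdot z=[f\cdot C]$ for any $C$ with $(\det_{\mathbb C}C)^2=z$. Lifted action: there is a $\Phi$-invariant compatible $J$, and unitary frame bundles of different compatible almost complex structures are isomorphic principal $\mathbb{U}(n)$-bundles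 over $M$. For invariant $J$, $\Phi^z_{\Gamma^2}[(u_1,\dots,v_n)]=[(\Phi^z_*u_1,\dots,\Phi^z_*v_n)]$, $z\in S^1$ (for general $J$, transport through such an isomorphism). It covers $\Phi$ and commutes with the inherent action. Maslov index of $\Phi$: a global section $\mathfrak s$ of $\Gamma_J^2$ gives the trivialization $tr_{\mathfrak s}:\Gamma_J^2\to M\times S^1$, $\mathfrak{s}(p)\cdot z\mapsto(p,z)$. For $w\in\Gamma_J^2$ put $\gamma_w(z)=\Phi^z_{\Gamma^2}(w)$; $\mathfrak{m}_{\mathfrak s}(\Phi)$ is the degree of $S^1\xrightarrow{\gamma_w}\Gamma_J^2\xrightarrow{tr_{\mathfrak s}}M\times S^1\xrightarrow{pr_{S^1}}S^1$, which is independent of $w$ as $\Gamma_J^2$ is connected. Local Maslov index: let $\frac{\partial}{\partial\theta}$ generate $t\mapsto w\cdot e^{2\pi i t}$ and let $f_\alpha$ be any real $S^1$-invariant $1$-form on $\Gamma_J^2$ with $f_\alpha(\frac{\partial}{\partial\theta})=1$ (a connection $1$-form). At a fixed point $p$, $k_p=\int_{\gamma_w}f_\alpha$ for $w\in\pi_{\Gamma_J^2}^{-1}(p)$, where $\gamma_w$ is parametrized by $t\mapsto\Phi_{\Gamma^2}^{e^{2\pi it}}(w)$, $t\in[0,1]$; this is independent of $w$ and of $f_\alpha$. *)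

(* Defs.v *)
From HB Require Import structures.
From mathcomp Require Import all_boot all_order all_algebra spectral.
From mathcomp Require Import all_classical all_reals all_analysis.
From mathcomp.real_closed Require Import complex.

Set Implicit Arguments.
Unset Strict Implicit.
Unset Printing Implicit Defensive.

Import Order.TTheory GRing.Theory Num.Theory.
Import numFieldNormedType.Exports.

Local Open Scope classical_set_scope.
Local Open Scope ring_scope.
Local Open Scope complex_scope.
Local Open Scope quotient_scope.

Section SmoothMaps.
Context {R : realType}.

(* [A] is always an open set in the uses below. *)
Fixpoint Cdiff (k : nat) (U V : normedModType R) (A : set U) (f : U -> V)
    : Prop :=
  match k with
  | 0%N => forall x, A x -> {for x, continuous f}
  | k'.+1 => (forall x, A x -> differentiable f x) /\
             (forall v : U, Cdiff k' A (fun x => 'd f x v))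
  end.

Definition smooth_on (U V : normedModType R) (A : set U) (f : U -> V) : Prop :=
  forall k, Cdiff k A f.

Definition Jac (m : nat) (f : 'cV[R]_m -> 'cV[R]_m) (x : 'cV[R]_m) : 'M[R]_m :=
  \matrix_(i, j) ('d f x (delta_mx j ord0 : 'cV[R]_m)) i ord0.

End SmoothMaps.

Record chart (R : realType) (M : topologicalType) (m : nat) := Chart {
  cdom : set M;
  cimg : set 'cV[R]_m;
  cmap : M -> 'cV[R]_m;
  cinv : 'cV[R]_m -> M;
  cdom_open : open cdom;
  cimg_open : open cimg;
  cmap_fun : set_fun cdom cimg cmap;
  cinv_fun : set_fun cimg cdom cinv;
  cmapK : {in cdom, cancel cmap cinv};
  cinvK : {in cimg, cancel cinv cmap};
  cmap_continuous : {within cdom, continuous cmap};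
  cinv_continuous : {within cimg, continuous cinv} }.

(* Every point has a preferred chart.  The tangent space at [p] is modelled by
   ['cV[R]_m]: a tangent vector is its column of coordinates in the preferred
   chart at [p]. *)
Record manifold (R : realType) (m : nat) := Manifold {
  mcarrier :> topologicalType;
  atlas : set (chart R mcarrier m);
  chart_at : mcarrier -> chart R mcarrier m;
  chart_atP : forall p, atlas (chart_at p) /\ cdom (chart_at p) p;
  atlas_smooth : forall c d, atlas c -> atlas d ->
    smooth_on (cmap c @` (cdom c `&` cdom d)) (cmap d \o cinv c);
  manifold_hausdorff : hausdorff_space mcarrier;
  manifold_second_countable : @second_countable mcarrier }.

Section Tangent.
Context {R : realType} {m : nat} {M : manifold R m}.
Implicit Types (c : chart R M m) (p : M).

(* Matrix from coordinates in [c] at [cinv c x] to those of the tangent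
   space there. *)
Definition from_chart c (x : 'cV[R]_m) : 'M[R]_m :=
  Jac (cmap (chart_at (cinv c x)) \o cinv c) x.

Definition to_chart c p : 'M[R]_m :=
  Jac (cmap c \o cinv (chart_at p)) (cmap (chart_at p) p).

Definition dmap (f : M -> M) p : 'M[R]_m :=
  Jac (cmap (chart_at (f p)) \o f \o cinv (chart_at p)) (cmap (chart_at p) p).

(* [om p] is the Gram matrix of a bilinear form on the tangent space at [p]. *)
Definition form_in_chart (om : M -> 'M[R]_m) c (x : 'cV[R]_m) : 'M[R]_m :=
  (from_chart c x)^T *m om (cinv c x) *m from_chart c x.

Definition endo_in_chart (J : M -> 'M[R]_m) c (x : 'cV[R]_m) : 'M[R]_m :=
  to_chart c (cinv c x) *m J (cinv c x) *m from_chart c x.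

Definition partial (i : 'I_m) (f : 'cV[R]_m -> R) (x : 'cV[R]_m) : R :=
  'D_(delta_mx i ord0 : 'cV[R]_m) f x.

Record symplectic_form := SymplecticForm {
  omega :> M -> 'M[R]_m;
  omega_smooth : forall c, atlas c ->
    smooth_on (cimg c) (form_in_chart omega c);
  omega_alt : forall p, (omega p)^T = - omega p;
  omega_nondegenerate : forall p, omega p \in unitmx;
  omega_closed : forall c x (i j k : 'I_m), atlas c -> cimg c x ->
    partial i (fun y => form_in_chart omega c y j k) x +
    partial j (fun y => form_in_chart omega c y k i) x +
    partial k (fun y => form_in_chart omega c y i j) x = 0 }.

(* Gram matrix of [g_J (u, v) = omega (J u, v)]. *)
Definition gram (om : symplectic_form) (J : M -> 'M[R]_m) p : 'M[R]_m :=
  (J p)^T *m om p.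

Record compatible (om : symplectic_form) (J : M -> 'M[R]_m) : Prop :=
  Compatible {
    acs_smooth : forall c, atlas c -> smooth_on (cimg c) (endo_in_chart J c);
    acs_square : forall p, J p *m J p = - 1%:M;
    gram_sym : forall p, (gram om J p)^T = gram om J p;
    gram_pos : forall p (u : 'cV[R]_m), u != 0 ->
      0 < (u^T *m gram om J p *m u) ord0 ord0 }.

End Tangent.

Arguments symplectic_form {R m} M.

Section Circle.
Context {R : realType}.

Definition circle : set R[i] := [set z | `|z| = 1].

Definition cis (t : R) : R[i] := cos (2 * pi * t) +i* sin (2 * pi * t).

Definition has_degree (g : R[i] -> R[i]) (d : int) : Prop :=
  exists theta : R -> R, [/\ continuous theta,
    forall t, g (cis t) = cis (theta t) & theta 1 - theta 0 = d%:~R].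

End Circle.

Section CircleActions.
Context {R : realType} {m : nat} {M : manifold R m}.

(* Only the values of [phi] on [circle] matter.  As [cis] is a smooth covering
   of the circle, smoothness on S^1 x M is smoothness of
   [(t, p) |-> phi (cis t) p], which is read in charts. *)
Record symplectic_circle_action (om : symplectic_form M) :=
  SymplecticCircleAction {
    phi :> R[i] -> M -> M;
    phi1 : forall p, phi 1 p = p;
    phiM : forall z z' p, circle z -> circle z' ->
      phi (z * z') p = phi z (phi z' p);
    phi_smooth : forall (t0 : R) (p0 : M),
      let c := chart_at p0 in let d := chart_at (phi (cis t0) p0) in
      exists O : set (R^o * 'cV[R]_m)%type,
        [/\ open O, O (t0, cmap c p0),
            forall t x, O (t, x) ->
              cimg c x /\ cdom d (phi (cis t) (cinv c x)) &
            smooth_on O (fun tx => cmap d (phi (cis tx.1) (cinv c tx.2)))];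
    phi_symplectic : forall z p, circle z ->
      (dmap (phi z) p)^T *m om (phi z p) *m dmap (phi z) p = om p }.

Definition fixed_point (Phi : R[i] -> M -> M) (p : M) : Prop :=
  forall z, circle z -> Phi z p = p.

Definition invariant_acs (Phi : R[i] -> M -> M) (J : M -> 'M[R]_m) : Prop :=
  forall z p, circle z -> dmap (Phi z) p *m J p = J (Phi z p) *m dmap (Phi z) p.

End CircleActions.

Section FrameBundle.
Context {R : realType} {m : nat} {M : manifold R m}.

(* [(p, F)]: the columns of [F] are tangent vectors at [p]. *)
Definition frames : Type := (M * 'M[R]_m)%type.

HB.instance Definition _ := Choice.on frames.

Definition frames_open (W : set frames) : Prop :=
  forall c : chart R M m, atlas c ->
    open [set xF : 'cV[R]_m * 'M[R]_m |
      cimg c xF.1 /\ W (cinv c xF.1, from_chart c xF.1 *m xF.2)].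

Lemma frames_openT : frames_open setT.
Proof.
move=> c _; rewrite (_ : [set _ | _] = (fst : 'cV[R]_m * 'M[R]_m -> _) @^-1` cimg c).
  by apply: open_comp => [x _|]; [exact: cvg_fst|exact: cimg_open].
by apply/seteqP; split => [x []|x].
Qed.

Lemma frames_openI : setI_closed frames_open.
Proof.
move=> A B oA oB c ac.
rewrite (_ : [set _ | _] =
  [set xF : 'cV[R]_m * 'M[R]_m |
     cimg c xF.1 /\ A (cinv c xF.1, from_chart c xF.1 *m xF.2)] `&`
  [set xF | cimg c xF.1 /\ B (cinv c xF.1, from_chart c xF.1 *m xF.2)]).
  by apply: openI; [exact: oA|exact: oB].
by apply/seteqP; split => x /= => [[? []]|[[? ?] []]].
Qed.

Lemma frames_open_bigU (I : Type) (f : I -> set frames) :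
  (forall i, frames_open (f i)) -> frames_open (\bigcup_i f i).
Proof.
move=> of_ c ac.
rewrite (_ : [set _ | _] = \bigcup_i
  [set xF : 'cV[R]_m * 'M[R]_m |
     cimg c xF.1 /\ f i (cinv c xF.1, from_chart c xF.1 *m xF.2)]).
  by apply: bigcup_open => i _; exact: of_.
apply/seteqP; split => x /=.
  by move=> [cx [i _ fi]]; exists i.
by move=> [i _ [cx fi]]; split => //; exists i.
Qed.

HB.instance Definition _ := isOpenTopological.Build frames
  frames_openT frames_openI frames_open_bigU.

Definition fmul (f : frames) (C : 'M[R]_m) : frames := (f.1, f.2 *m C).

Definition fpush (h : M -> M) (f : frames) : frames :=
  (h f.1, dmap h f.1 *m f.2).

Definition fcoord (c : chart R M m) (f : frames) : 'cV[R]_m * 'M[R]_m :=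
  (cmap c f.1, to_chart c f.1 *m f.2).

End FrameBundle.

Arguments frames {R m} M.

Section UnitaryGroup.
Context {R : realType} {n : nat}.

(* The real matrix [A, -B; B, A] of [U = A + iB]. *)
Definition realify (U : 'M[R[i]]_n) : 'M[R]_(n + n) :=
  let A := map_mx (@complex.Re R) U in let B := map_mx (@complex.Im R) U in
  block_mx A (- B) B A.

Definition in_EU (U : 'M[R[i]]_n) : Prop :=
  U \is unitarymx /\ (\det U = 1 \/ \det U = -1).

Lemma realify1 : realify 1%:M = 1%:M.
Proof.
rewrite /realify [RHS](scalar_mx_block n n); congr block_mx;
  by apply/matrixP => i j; rewrite !mxE; case: (i == j); rewrite /= ?oppr0.
Qed.

Lemma realifyM U V : realify (U *m V) = realify U *m realify V.
Proof.
rewrite /realify mulmx_block.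
have ReD := raddf_sum (@complex.Re R : {additive _ -> _}).
have ImD := raddf_sum (@complex.Im R : {additive _ -> _}).
have eRe : map_mx (@complex.Re R) (U *m V) =
  map_mx (@complex.Re R) U *m map_mx (@complex.Re R) V -
  map_mx (@complex.Im R) U *m map_mx (@complex.Im R) V.
  apply/matrixP => i j; rewrite !mxE ReD -sumrB; apply: eq_bigr => k _.
  by rewrite !mxE; case: (U i k) => a b; case: (V k j).
have eIm : map_mx (@complex.Im R) (U *m V) =
  map_mx (@complex.Re R) U *m map_mx (@complex.Im R) V +
  map_mx (@complex.Im R) U *m map_mx (@complex.Re R) V.
  apply/matrixP => i j; rewrite !mxE ImD -big_split; apply: eq_bigr => k _.
  by rewrite !mxE; case: (U i k) => a b; case: (V k j).
by rewrite eRe eIm !mulNmx !mulmxN opprD; congr block_mx; rewrite addrC.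
Qed.

End UnitaryGroup.

Section MaslovBundle.
Context {R : realType} {n : nat} {M : manifold R (n + n)}.
Variables (om : symplectic_form M) (J : M -> 'M[R]_(n + n)).

(* The columns of [lsubmx f.2] and [rsubmx f.2] are the vectors
   u_1, ..., u_n and v_1, ..., v_n of the frame. *)
Definition unitary_frame (f : frames M) : Prop :=
  let u := lsubmx f.2 in let v := rsubmx f.2 in let g := gram om J f.1 in
  [/\ f.2 \in unitmx, v = - (J f.1 *m u),
      u^T *m g *m u = 1%:M & u^T *m g *m v = 0].

Definition ufr : Type := set_type [set f | unitary_frame f].

HB.instance Definition _ := Topological.on ufr.

Definition ufr_base (f : ufr) : M := (set_val f).1.

(* [f' = f . U] for the right action of the unitary group on frames. *)
Definition ufr_mul (f : ufr) (U : 'M[R[i]]_n) (f' : ufr) : Prop :=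
  set_val f' = fmul (set_val f) (realify U).

Definition eu_rel : rel ufr :=
  fun f f' => `[< exists2 U, in_EU U & ufr_mul f U f' >].

Lemma eu_rel_equiv : equiv_class_of eu_rel.
Proof.
have fmulA (f : frames M) (U V : 'M[R[i]]_n) :
    fmul (fmul f (realify U)) (realify V) = fmul f (realify (U *m V)).
  by rewrite /fmul /= realifyM mulmxA.
have eu_sym f f' : eu_rel f f' -> eu_rel f' f.
  move=> /asboolP[U [uU dU] ff']; apply/asboolP.
  have UV : U *m invmx U = 1%:M by rewrite mulmxV ?unitarymx_unit.
  exists (invmx U).
    split; first by rewrite invmx_unitary ?trmxC_unitary.
    by rewrite det_inv; case: dU => ->; [left|right]; rewrite ?invr1 ?invrN1.
  rewrite /ufr_mul ff' fmulA UV realify1 /fmul mulmx1.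
  by case: (set_val f).
split.
- move=> f; apply/asboolP; exists 1%:M.
    by split; [apply/unitarymxP; rewrite trmx1 map_mx1 mulmx1|left; rewrite det1].
  by rewrite /ufr_mul realify1 /fmul mulmx1; case: (set_val f).
- by move=> f f'; apply/idP/idP; exact: eu_sym.
- move=> f2 f1 f3 /asboolP[U [uU dU] e12] /asboolP[V [uV dV] e23].
  apply/asboolP; exists (U *m V); last by rewrite /ufr_mul e23 e12 fmulA.
  split; first exact: mul_unitarymx.
  by rewrite det_mulmx; case: dU dV => -> [] ->; rewrite ?mul1r ?mulr1 ?mulrNN
    ?mulr1; by [left|right].
Qed.

Canonical eu_equiv := EquivRelPack eu_rel_equiv.

Definition maslov_bundle : Type := quotient_topology {eq_quot eu_equiv}.

HB.instance Definition _ := Topological.on maslov_bundle.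
HB.instance Definition _ := Quotient.on maslov_bundle.

Definition frame_class (f : ufr) : maslov_bundle := \pi_maslov_bundle f.

Definition bundle_proj (w : maslov_bundle) : M := ufr_base (repr w).

(* For z on the circle this is [f . U] for any representative [f] of [w] and any
   unitary [U] with [det U ^ 2 = z]; the value does not depend on the choices. *)
Definition inherent_act (w : maslov_bundle) (z : R[i]) : maslov_bundle :=
  xget w [set w' | exists f f' U, [/\ w = frame_class f, w' = frame_class f',
    U \is unitarymx, (\det U) ^+ 2 = z & ufr_mul f U f']].

Definition trivial_bundle : Prop :=
  exists (T : maslov_bundle -> M * R[i]^o) (S : M * R[i]^o -> maslov_bundle),
    [/\ continuous T, {within [set x : M * R[i]^o | circle x.2], continuous S},
        forall w, S (T w) = w, forall x, circle x.2 -> T (S x) = x &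
        forall w, [/\ (T w).1 = bundle_proj w, circle (T w).2 &
          forall z, circle z -> T (inherent_act w z) = ((T w).1, (T w).2 * z)]].

Definition global_section (s : M -> maslov_bundle) : Prop :=
  continuous s /\ forall p, bundle_proj (s p) = p.

(* [tr_section s (s p . z) = (p, z)] *)
Definition tr_section (s : M -> maslov_bundle) (w : maslov_bundle) : M * R[i] :=
  (bundle_proj w,
   xget 1 [set z | circle z /\ w = inherent_act (s (bundle_proj w)) z]).

Definition ufr_smooth (F : ufr -> R) : Prop :=
  forall f0 : ufr, let c := chart_at (ufr_base f0) in
    exists (O : set ('cV[R]_(n + n) * 'M[R]_(n + n))%type)
           (G : 'cV[R]_(n + n) * 'M[R]_(n + n) -> R^o),
      [/\ open O, O (fcoord c (set_val f0)), smooth_on O G &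
        forall f : ufr, cdom c (ufr_base f) -> O (fcoord c (set_val f)) ->
          F f = G (fcoord c (set_val f))].

(* [ufr] is an embedded submanifold of the frame bundle, and [frame_class] a
   surjective submersion. *)
Definition bundle_smooth (F : maslov_bundle -> R) : Prop :=
  ufr_smooth (F \o frame_class).

End MaslovBundle.

(* Tangent vectors as derivations of the algebra [C] of smooth functions on [X];
   two derivations that agree on [C] are the same tangent vector. *)
Section OneForms.
Context {R : realType} {X : Type}.
Variable C : set (X -> R).

Definition derivation (w : X) (D : (X -> R) -> R) : Prop :=
  (forall F G (a : R), C F -> C G ->
     D (fun x => a * F x + G x) = a * D F + D G) /\
  (forall F G, C F -> C G ->
     D (fun x => F x * G x) = D F * G w + F w * D G).

Definition vector_field (V : X -> (X -> R) -> R) : Prop :=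
  (forall w, derivation w (V w)) /\
  (forall F, C F -> C (fun w => V w F)).

Record one_form (alpha : X -> ((X -> R) -> R) -> R) : Prop := OneForm {
  one_form_ext : forall w D D', derivation w D -> derivation w D' ->
    (forall F, C F -> D F = D' F) -> alpha w D = alpha w D';
  one_form_linear : forall w D D' (a : R), derivation w D -> derivation w D' ->
    alpha w (fun F => a * D F + D' F) = a * alpha w D + alpha w D';
  one_form_smooth : forall V, vector_field V -> C (fun w => alpha w (V w)) }.

Definition velocity (gamma : R -> X) (t : R) : (X -> R) -> R :=
  fun F => derive1 (F \o gamma) t.

Definition line_integral (alpha : X -> ((X -> R) -> R) -> R) (gamma : R -> X)
    : R :=
  Rintegral lebesgue_measure `[0, 1]
    (fun t => alpha (gamma t) (velocity gamma t)).

End OneForms.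

Section MaslovIndex.
Context {R : realType} {n : nat} {M : manifold R (n + n)}.
Variables (om : symplectic_form M) (J : M -> 'M[R]_(n + n)).

Definition fundamental_vector (w : maslov_bundle om J)
    : (maslov_bundle om J -> R) -> R :=
  velocity (fun t => inherent_act w (cis t)) 0.

Definition translate (z : R[i]) (D : (maslov_bundle om J -> R) -> R)
    : (maslov_bundle om J -> R) -> R :=
  fun F => D (fun w => F (inherent_act w z)).

Record connection_form
    (alpha : maslov_bundle om J -> ((maslov_bundle om J -> R) -> R) -> R)
    : Prop := ConnectionForm {
  connection_one_form : one_form (@bundle_smooth R n M om J) alpha;
  connection_invariant : forall w z D, circle z ->
    derivation (@bundle_smooth R n M om J) w D ->
    alpha (inherent_act w z) (translate z D) = alpha w D;
  connection_fundamental : forall w, alpha w (fundamental_vector w) = 1 }.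

Definition principal_iso (J' : M -> 'M[R]_(n + n))
    (Psi : ufr om J' -> ufr om J) : Prop :=
  [/\ continuous Psi,
      exists2 Psi' : ufr om J -> ufr om J', continuous Psi' &
        cancel Psi Psi' /\ cancel Psi' Psi,
      forall f, ufr_base (Psi f) = ufr_base f &
      forall f f' U, U \is unitarymx -> ufr_mul f U f' ->
        ufr_mul (Psi f) U (Psi f')].

(* [f'] is the image of the unitary frame [f] under the differential of
   [Phi z]; it is again unitary because [J'] is invariant. *)
Definition lifted_action (Phi : R[i] -> M -> M)
    (L : R[i] -> maslov_bundle om J -> maslov_bundle om J) : Prop :=
  exists (J' : M -> 'M[R]_(n + n)) (Psi : ufr om J' -> ufr om J),
    [/\ compatible om J', invariant_acs Phi J', principal_iso Psi &
      forall z (f f' : ufr om J'), circle z ->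
        set_val f' = fpush (Phi z) (set_val f) ->
        L z (frame_class (Psi f)) = frame_class (Psi f')].

Definition is_maslov_index (L : R[i] -> maslov_bundle om J -> maslov_bundle om J)
    (s : M -> maslov_bundle om J) (k : int) : Prop :=
  forall w, has_degree (fun z => (tr_section s (L z w)).2) k.

Definition is_local_maslov_index
    (L : R[i] -> maslov_bundle om J -> maslov_bundle om J) (p : M) (k : R)
    : Prop :=
  forall alpha w, connection_form alpha -> bundle_proj w = p ->
    line_integral alpha (fun t => L (cis t) w) = k.

End MaslovIndex.

(* Main.v *)
(* The lifted action commutes with the inherent one, so over a fixed point p it is
   w |-> w . chi(z) for a character chi of the circle, that is chi(z) = z^m.  Read in any
   section this loop has degree m, and the orbit of w is the inherent orbit run through
   m times, so every connection form integrates to m along it.  By compactness of the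
   circle, the degree of z |-> L z w in a fixed section is locally constant in the base
   point, hence constant as M is connected; this makes m the degree at every point and
   for every section. *)

Require Import Defs.
From mathcomp Require Import all_boot all_order all_algebra spectral.
From mathcomp Require Import all_classical all_reals all_analysis.
From mathcomp.real_closed Require Import complex.
From mathcomp Require Import ring lra zify.

Set Implicit Arguments.
Unset Strict Implicit.
Unset Printing Implicit Defensive.

Import Order.TTheory GRing.Theory Num.Theory.
Import numFieldNormedType.Exports.

Local Open Scope classical_set_scope.
Local Open Scope ring_scope.

(** * The unit circle and degrees of its self-maps *)

(** No covering theory is used. Over a fixed point the loop is a rotation and its lift is explicit;
    a lift reaches nearby base points by adding the arcsine argument of a quotient with positive
    real part. Existence of the degree at the other points thus comes together with its value. A
    trivialization turns each question about a fibre into one about the angle [(T w).2]: as [T] is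
    injective and equivariant, the laws of the inherent action and its transitivity on fibres are
    read off from multiplication on the circle. Most of the labour goes into the joint continuity of
    [(t, w) |-> L (cis t) w]. Two obstacles shape it. Tangent vectors are coordinates in preferred
    charts, which need not vary continuously with the point, so the push-forward of frames must
    first be rewritten in fixed charts. And the Maslov bundle carries a quotient topology, which
    does not in general commute with products, so the map from frames to classes has to be shown
    open. *)

Section CircleTheory.
Context {R : realType}.
Implicit Types (z w : R[i]) (t : R).

Local Notation Re := (@complex.Re R).
Local Notation Im := (@complex.Im R).

Lemma ReM z w : Re (z * w) = Re z * Re w - Im z * Im w.
Proof. by case: z w => a b []. Qed.

Lemma ImM z w : Im (z * w) = Re z * Im w + Im z * Re w.
Proof. by case: z w => a b []. Qed.

Lemma complex_ext z w : Re z = Re w -> Im z = Im w -> z = w.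
Proof. by case: z w => a b [c d] /= -> ->. Qed.

Lemma circleE z : circle z <-> Re z ^+ 2 + Im z ^+ 2 = 1.
Proof.
rewrite /circle /= normc_def; split => [[h]|->]; last by rewrite sqrtr1.
by rewrite -[LHS]sqr_sqrtr ?h ?expr1n // addr_ge0 ?sqr_ge0.
Qed.

Lemma circle1 : circle (1 : R[i]).
Proof. by rewrite /circle /= normr1. Qed.

Lemma circleM z w : circle z -> circle w -> circle (z * w).
Proof. by rewrite /circle /= normrM => -> ->; rewrite mulr1. Qed.

Lemma circleJ z : circle z -> circle (conjc z).
Proof. by move=> /circleE zE; apply/circleE; case: z zE => a b /=; rewrite sqrrN. Qed.

Lemma circle_mulJ z : circle z -> z * conjc z = 1.
Proof.
move=> /circleE; case: z => a b /= zE.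
by apply: complex_ext; rewrite /= -?zE; ring.
Qed.

Lemma circle_neq0 z : circle z -> z != 0.
Proof. by rewrite /circle /= => z1; rewrite -normr_eq0 z1 oner_neq0. Qed.

Lemma circle_cis t : circle (cis t : R[i]).
Proof. by apply/circleE; rewrite /= cos2Dsin2. Qed.

Lemma cisD s t : cis (s + t) = cis s * cis t :> R[i].
Proof. by apply: complex_ext; rewrite /= mulrDr (cosD, sinD) // addrC. Qed.

Lemma cis0 : cis 0 = 1 :> R[i].
Proof. by apply: complex_ext; rewrite /= mulr0 (cos0, sin0). Qed.

Lemma cis1 : cis 1 = 1 :> R[i].
Proof.
by apply: complex_ext; rewrite /= mulr1 mulr_natl (cos2pi, sin2pi).
Qed.

Lemma cisN t : cis (- t) = conjc (cis t) :> R[i].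
Proof. by apply: complex_ext; rewrite /= mulrN (cosN, sinN). Qed.

Lemma cis_nat (n : nat) t : cis (n%:R * t) = cis t ^+ n :> R[i].
Proof.
elim: n => [|n ih]; first by rewrite mul0r cis0.
by rewrite exprS -ih -cisD -{1}addn1 natrD mulrDl mul1r addrC.
Qed.

Lemma cis_int (k : int) : cis k%:~R = 1 :> R[i].
Proof.
case: k => n; first by rewrite -[X in cis X]mulr1 cis_nat cis1 expr1n.
rewrite NegzE rmorphN /= cisN -[X in cis X]mulr1 cis_nat cis1 expr1n.
by apply: complex_ext; rewrite //= oppr0.
Qed.

(** Once the floor is removed, [cos (2 * pi * y) = 1 - 2 * sin (pi * y) ^+ 2] is less than 1 for
    [0 < y < 1], because sine is positive strictly between 0 and [pi]. *)
Lemma cis_eq1 t : cis t = 1 :> R[i] -> exists k : int, t = k%:~R.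
Proof.
move=> t1; exists (Num.floor t).
set y := t - (Num.floor t)%:~R.
have y1 : cis y = 1 :> R[i] by rewrite cisD -mulrNz cis_int mulr1.
have [y0 ylt] : 0 <= y /\ y < 1.
  by rewrite subr_ge0 ltrBlDl floor_le_tmp -intrD1 floorD1_gt.
suff : y = 0 by move/subr0_eq.
apply/eqP/negPn/negP => yn0.
have sy : 0 < sin (pi * y).
  apply: sin_gt0_pi; rewrite mulr_gt0 ?pi_gt0 ?lt0r ?yn0 //=.
  by rewrite gtr_pMr ?pi_gt0.
have := congr1 Re y1; rewrite /= -mulrA mulr_natl cos_mulr2n cos2sin2.
nra.
Qed.

Lemma cis_inj s t : cis s = cis t :> R[i] -> exists k : int, s - t = k%:~R.
Proof.
by move=> st; apply: cis_eq1; rewrite cisD cisN st circle_mulJ //; exact: circle_cis.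
Qed.

Lemma cis_frac t : exists2 u, 0 <= u <= 1 & cis t = cis u :> R[i].
Proof.
exists (t - (Num.floor t)%:~R); last by rewrite cisD -mulrNz cis_int mulr1.
by rewrite subr_ge0 floor_le_tmp lerBlDl -intrD1 ltW // floorD1_gt.
Qed.

Lemma circle_cis_surj z : circle z -> exists t, z = cis t.
Proof.
move=> /circleE zE.
have Re1 : -1 <= Re z <= 1 by apply/andP; split; nra.
have pi2 : 2 * pi != 0 :> R by rewrite mulf_neq0 // gt_eqF // pi_gt0.
have sinE : sin (acos (Re z)) = `|Im z|.
  by rewrite sin_acos // -zE addrC addKr sqrtr_sqr.
have [i0|i0] := leP 0 (Im z).
  exists (acos (Re z) / (2 * pi)); apply: complex_ext; rewrite /= mulrC divfK //.
    by rewrite acosK // in_itv.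
  by rewrite sinE ger0_norm.
exists (- (acos (Re z) / (2 * pi))); apply: complex_ext.
  by rewrite /= mulrN cosN mulrC divfK // acosK // in_itv.
by rewrite /= mulrN sinN mulrC divfK // sinE ltr0_norm ?opprK.
Qed.

(* The argument in turns of a point of the right half circle. *)
Definition carg z : R := asin (Im z) / (2 * pi).

Lemma circle_Im z : circle z -> 0 < Re z -> -1 < Im z < 1.
Proof. by move=> /circleE zE z0; apply/andP; split; nra. Qed.

Lemma cargK z : circle z -> 0 < Re z -> cis (carg z) = z.
Proof.
move=> cz z0; have /andP[i1 i2] := circle_Im cz z0.
have Im1 : -1 <= Im z <= 1 by rewrite !ltW.
have pi2 : 2 * pi != 0 :> R by rewrite mulf_neq0 // gt_eqF // pi_gt0.
move/circleE : cz => zE.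
apply: complex_ext; rewrite /= mulrC divfK //; last by rewrite asinK // in_itv.
by rewrite cos_asin // -zE addrK sqrtr_sqr gtr0_norm.
Qed.

(** Keeps the angle in a range where cosine decreases with its absolute value, so that angles can be
    compared through cosines in [circle_hom]. *)
Lemma carg_pihalf z : circle z -> 0 < Re z -> `|2 * pi * carg z| <= pi / 2.
Proof.
move=> cz z0; have /andP[i1 i2] := circle_Im cz z0.
have Im1 : -1 <= Im z <= 1 by rewrite !ltW.
have pi2 : 2 * pi != 0 :> R by rewrite mulf_neq0 // gt_eqF // pi_gt0.
by rewrite mulrC divfK // ler_norml asin_geNpi2 ?asin_lepi2.
Qed.

(** Continuity is asked of the two real coordinates, so that all estimates take place in [R]; the
    link with the topology of [R[i]^o] is made by [Re_continuous] and [Im_continuous]. *)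
Definition ccontinuous (X : topologicalType) (g : X -> R[i]) : Prop :=
  continuous (fun x => Re (g x)) /\ continuous (fun x => Im (g x)).

Lemma ccontinuousM (X : topologicalType) (f g : X -> R[i]) :
  ccontinuous f -> ccontinuous g -> ccontinuous (fun x => f x * g x).
Proof.
move=> [fr fi] [gr gi]; split => x.
  by under eq_fun do rewrite ReM; apply: cvgB; apply: cvgM;
    [exact: fr|exact: gr|exact: fi|exact: gi].
by under eq_fun do rewrite ImM; apply: cvgD; apply: cvgM;
    [exact: fr|exact: gi|exact: fi|exact: gr].
Qed.

Lemma ccontinuousJ (X : topologicalType) (f : X -> R[i]) :
  ccontinuous f -> ccontinuous (fun x => conjc (f x)).
Proof.
move=> [fr fi]; split => x.
  rewrite (_ : (fun _ => _) = (fun x => Re (f x))); first exact: fr.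
  by apply/funext => y; case: (f y).
rewrite (_ : (fun _ => _) = (fun x => - Im (f x))); first by apply: cvgN; exact: fi.
by apply/funext => y; case: (f y).
Qed.

Lemma ccontinuous_comp (X Y : topologicalType) (f : Y -> R[i]) (h : X -> Y) :
  continuous h -> ccontinuous f -> ccontinuous (fun x => f (h x)).
Proof.
move=> hc [fr fi]; split => x.
  by apply: (@continuous_comp _ _ _ h (fun y => Re (f y))); [exact: hc|exact: fr].
by apply: (@continuous_comp _ _ _ h (fun y => Im (f y))); [exact: hc|exact: fi].
Qed.

Lemma ccontinuous_cst (X : topologicalType) z : ccontinuous (fun _ : X => z).
Proof. by split => x; exact: cvg_cst. Qed.

Lemma continuous_carg (X : topologicalType) (g : X -> R[i]) :
  ccontinuous g -> (forall x, circle (g x)) -> (forall x, 0 < Re (g x)) ->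
  continuous (fun x => carg (g x)).
Proof.
move=> [_ gi] gc g0 x; apply: cvgM; last exact: cvg_cst.
apply: (@continuous_comp _ _ _ (fun x => Im (g x)) (@asin R)); first exact: gi.
exact/continuous_asin/circle_Im.
Qed.

(** If two values differed, the intermediate value theorem would give the value [k + 1/2], with [k]
    the smaller of the two integers. *)
Lemma continuous_int_valued_cst (f : R -> R) : continuous f ->
  (forall t, exists k : int, f t = k%:~R) -> forall s t, f s = f t.
Proof.
move=> fc fint.
suff le_ s t : s <= t -> f s = f t.
  by move=> s t; have [/le_|/ltW/le_] := leP s t.
move=> st; have fcst : {within `[s, t], continuous f} by exact: continuous_subspaceT.
have [k fk] := fint s; have [l fl] := fint t.
have noninteger (a b : int) : a%:~R + 2^-1 <> b%:~R :> R.
  move=> ab; have : ((a + a + 1)%:~R : R) = (b + b)%:~R.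
    by rewrite !intrD -ab; field.
  move/intr_inj; lia.
apply/eqP/negPn/negP; rewrite neq_lt fk fl !ltr_int => /orP[kl|lk].
  have : Num.min (f s) (f t) <= k%:~R + 2^-1 <= Num.max (f s) (f t).
    have : (k + 1)%:~R <= l%:~R :> R by rewrite ler_int; lia.
    by rewrite fk fl intrD => ?; rewrite ge_min le_max; apply/andP; split; apply/orP;
      [left|right]; lra.
  by move=> /(IVT st fcst)[c _]; have [j ->] := fint c => /esym/noninteger.
have : Num.min (f s) (f t) <= l%:~R + 2^-1 <= Num.max (f s) (f t).
  have : (l + 1)%:~R <= k%:~R :> R by rewrite ler_int; lia.
  by rewrite fk fl intrD => ?; rewrite ge_min le_max; apply/andP; split; apply/orP;
    [right|left]; lra.
by move=> /(IVT st fcst)[c _]; have [j ->] := fint c => /esym/noninteger.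
Qed.

(** Two lifts of the same loop differ by a continuous integer-valued function, hence by a constant,
    so they have the same increment. *)
Lemma degree_unique (g : R[i] -> R[i]) (d e : int) :
  has_degree g d -> has_degree g e -> d = e.
Proof.
move=> [th [thc gth thd]] [th' [thc' gth' th'e]].
have thB : continuous (fun t => th t - th' t).
  by move=> t; apply: cvgB; [exact: thc|exact: thc'].
have := continuous_int_valued_cst thB.
have thint t : exists k : int, th t - th' t = k%:~R.
  by apply: cis_inj; rewrite -gth gth'.
move=> /(_ thint 1 0) th10; apply: (@intr_inj R); rewrite -thd -th'e; lra.
Qed.

(* On the unit circle [1 - Re (z ^+ 2) = 2 * (1 - Re z) * (1 + Re z)], so squaring
   at least doubles [1 - Re z] as long as [Re z >= 0]. *)
Lemma right_half_circle_power z : circle z ->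
  (forall k, 0 < Re (z ^+ (2 ^ k))) -> z = 1.
Proof.
move=> cz zk.
have dbl k : 2 ^+ k * (1 - Re z) <= 1 - Re (z ^+ (2 ^ k)).
  elim: k => [|k ih]; first by rewrite expr0 mul1r expn0 expr1.
  have cX : circle (z ^+ (2 ^ k)).
    by rewrite /circle /= normrX; move: cz; rewrite /circle /= => ->; rewrite expr1n.
  move/circleE : cX (zk k) ih; rewrite expnS mulnC exprM expr2 ReM.
  set x := Re _; set y := Im _; set u := 2 ^+ k * _ => xy x0.
  move=> ux; have -> : 2 ^+ k.+1 * (1 - Re z) = 2 * u by rewrite /u exprS mulrA.
  by nra.
have z1 : Re z <= 1 by move/circleE : cz; nra.
have Re1 : Re z = 1.
  apply/eqP; rewrite eq_le z1 /= leNgt; apply/negP => zlt.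
  have [k kP] : exists k : nat, (1 - Re z)^-1 < k%:R.
    by exists (Num.bound (1 - Re z)^-1); rewrite archi_boundP // invr_ge0 subr_ge0.
  have : k%:R <= 2 ^+ k :> R by rewrite -natrX ler_nat ltnW // ltn_expl.
  have := dbl k; have := zk k; have z0 : 0 < 1 - Re z by rewrite subr_gt0.
  have : 1 < k%:R * (1 - Re z) by rewrite -ltr_pdivrMr // mul1r.
  nra.
by move/circleE : cz; rewrite Re1 => h; apply: complex_ext; rewrite ?Re1 //=; nra.
Qed.

(** The integer is read off at a small time [tau = 1 / N]: if [chi tau = cis a], then [chi 1 = 1]
    forces [N * a] to be an integer [m]. Dividing [chi] by [cis (m * t)] leaves a homomorphism [psi]
    that is trivial at [tau] and takes all its values in the right half circle. Powers of values of
    [psi] are again values of [psi], so [right_half_circle_power] makes it trivial. *)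
Lemma circle_hom (chi : R -> R[i]) : ccontinuous chi ->
  (forall t, circle (chi t)) -> (forall s t, chi (s + t) = chi s * chi t) ->
  chi 1 = 1 -> exists m : int, forall t, chi t = cis (m%:~R * t).
Proof.
move=> chic chi_circle chiD chi1.
have chi0 : chi 0 = 1.
  by apply: (mulfI (circle_neq0 (chi_circle 0))); rewrite -chiD addr0 mulr1.
(* For two points of the circle with real parts above [c], the real part of either one times the
   conjugate of the other exceeds [2 * c ^+ 2 - 1]; any [c] above the cosine of [pi / 4] makes this
   positive, and 4/5 is a rational choice. *)
have [N N0 chiN] : exists2 N : nat, (0 < N)%N &
    forall t, `|t| <= N%:R^-1 -> 4 / 5 < Re (chi t).
  have : \forall t \near (0 : R), 4 / 5 < Re (chi t).
    have := chic.1 0; rewrite /continuous_at chi0 /= => /cvgr_gt; apply; lra.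
  move=> /nbhs_ballP[e /= e0 he].
  have bound_e : e^-1 < (Num.bound e^-1)%:R by rewrite archi_boundP // invr_ge0 ltW.
  exists (Num.bound e^-1).
    by rewrite -(ltr_nat R) (lt_trans _ bound_e) // invr_gt0.
  move=> t tN; apply: he; rewrite /ball /= sub0r normrN (le_lt_trans tN) //.
  by rewrite invf_plt ?posrE // (lt_trans _ bound_e) // invr_gt0.
have N0' : 0 < N%:R :> R by rewrite ltr0n.
set tau : R := N%:R^-1.
have tau0 : 0 < tau by rewrite invr_gt0.
have chi_tau : 4 / 5 < Re (chi tau) by apply: chiN; rewrite ger0_norm // ltW.
have chi_tau0 : 0 < Re (chi tau) by lra.
set a := carg (chi tau).
have aE : cis a = chi tau by apply: cargK.
have chi_nat k t : chi (k%:R * t) = chi t ^+ k.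
  elim: k => [|k ih]; first by rewrite mul0r chi0.
  by rewrite exprS -ih -chiD -{1}addn1 natrD mulrDl mul1r addrC.
have [m mE] : exists m : int, N%:R * a = m%:~R.
  by apply: cis_eq1; rewrite cis_nat aE -chi_nat divff // gt_eqF.
exists m => t.
pose psi s := chi s * cis (- (m%:~R * s)).
have psiD s u : psi (s + u) = psi s * psi u.
  by rewrite /psi chiD mulrDr opprD cisD; ring.
have psi_circle s : circle (psi s) by apply: circleM => //; exact: circle_cis.
have psi_tau : psi tau = 1.
  by rewrite /psi -mE mulrAC divff ?gt_eqF // mul1r cisN aE circle_mulJ.
have psi0 : psi 0 = 1 by rewrite /psi chi0 mulr0 oppr0 cis0 mulr1.
have psi_small s : `|s| <= tau -> 0 < Re (psi s).
  move=> s_tau; have chi_s := chiN _ s_tau.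
  (* From [m = N * a] and [|s| <= 1 / N] the angle of [cis (m * s)] is at most that of [chi tau] in
     absolute value, and cosine decreases on [[0, pi]]. *)
  have cos_s : 4 / 5 < cos (2 * pi * (m%:~R * s)).
    rewrite (lt_le_trans chi_tau) // -aE /= -[leLHS]cos_norm -[leRHS]cos_norm.
    have piS : `|2 * pi * (m%:~R * s)| <= `|2 * pi * a|.
      rewrite -mE !(normrM (2 * pi)); apply: ler_wpM2l => //.
      rewrite (normrM (N%:R * a)) (normrM N%:R) mulrAC ler_piMl // normr_nat.
      by rewrite -ler_pdivlMl // mulr1.
    have a2 := carg_pihalf (chi_circle tau) chi_tau0.
    have pi0 := pi_gt0 R.
    rewrite -/a in a2.
    have [->//|ne] := eqVneq `|2 * pi * (m%:~R * s)| `|2 * pi * a|.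
    rewrite ltW // ltr_cos ?in_itv /= ?normr_ge0 /=.
    - by rewrite lt_neqAle ne.
    - lra.
    - lra.
  have /circleE := chi_circle s; have := cos2Dsin2 (2 * pi * (m%:~R * s)).
  rewrite /psi cisN ReM /=.
  set x := Re _; set y := Im _; set c := cos _; set d := sin _ => cd xy.
  have c0 : 4 / 5 < c by [].
  have x0 : 4 / 5 < x by [].
  have yd := sqr_ge0 (y + d).
  have xc : 16 / 25 < x * c by nra.
  have x2 : 16 / 25 < x ^+ 2 by nra.
  have c2 : 16 / 25 < c ^+ 2 by nra.
  nra.
(* Since [psi tau = 1], [psi] has period [tau], and every argument reduces to one of size at most
   [tau]. *)
have psi_pos s : 0 < Re (psi s).
  have psi_natz (k : int) : psi (k%:~R * tau) = 1.
    have psi_nat (n : nat) : psi (n%:R * tau) = 1.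
      elim: n => [|n ih]; first by rewrite mul0r.
      by rewrite -addn1 natrD mulrDl psiD ih !mul1r psi_tau.
    case: k => n; first exact: psi_nat.
    have := psiD ((Negz n)%:~R * tau) (n.+1%:R * tau).
    by rewrite NegzE rmorphN /= mulNr addNr psi0 psi_nat mulr1 => <-.
  rewrite -[s](subrK ((Num.floor (s * N%:R))%:~R * tau)) psiD psi_natz mulr1.
  apply: psi_small.
  have /andP[f1 f2] := floor_itv (s * N%:R).
  have sE : s = s * N%:R * tau by rewrite /tau mulfK // gt_eqF.
  rewrite {1}sE -mulrBl normrM [`|tau|]gtr0_norm // ler_piMl ?(ltW tau0) //.
  rewrite ger0_norm ?subr_ge0 // lerBlDl ltW //.
  by rewrite -intrD1.
have psi1 : psi t = 1.
  apply: right_half_circle_power => // k.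
  suff -> : psi t ^+ (2 ^ k) = psi ((2 ^ k)%:R * t) by [].
  elim: (2 ^ k)%N => [|n ih]; first by rewrite mul0r psi0.
  by rewrite exprS ih -psiD -{1}addn1 natrD mulrDl mul1r addrC.
have := circle_mulJ (circle_cis (m%:~R * t)).
move: psi1; rewrite /psi cisN => psi1 cisJ.
apply: (mulIf (circle_neq0 (circleJ (circle_cis (m%:~R * t))))).
by rewrite psi1 cisJ.
Qed.

Lemma continuous_at_pair (X Y Z : topologicalType) (f : X -> Y) (g : X -> Z) x :
  {for x, continuous f} -> {for x, continuous g} ->
  {for x, continuous (fun y => (f y, g y))}.
Proof. by move=> fc gc; exact: cvg_pair fc gc. Qed.

(** The quotient [q] of the two loops stays in the right half circle, where [carg] is a continuous
    argument, so [th + carg q] lifts [h]. The correction takes the same value at 0 and at 1, because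
    [cis 0 = cis 1], and does not change the increment. *)
Lemma has_degree_near (g h : R[i] -> R[i]) (d : int) :
  ccontinuous (fun t : R => g (cis t)) -> ccontinuous (fun t : R => h (cis t)) ->
  (forall t : R, circle (g (cis t))) -> (forall t : R, circle (h (cis t))) ->
  (forall t, 0 < Re (h (cis t) * conjc (g (cis t)))) ->
  has_degree g d -> has_degree h d.
Proof.
move=> gc hc gcirc hcirc hg0 [th [thc gth thd]].
pose q t := h (cis t) * conjc (g (cis t)).
have qcirc t : circle (q t) by apply: circleM => //; exact: circleJ.
exists (fun t => th t + carg (q t)); split.
- move=> t; apply: cvgD; first exact: thc.
  apply: continuous_carg => //; apply: ccontinuousM => //; exact: ccontinuousJ.
- move=> t; rewrite cisD (cargK (qcirc t) (hg0 t)) -gth /q mulrCA circle_mulJ ?mulr1 //.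
- by rewrite /q cis0 cis1 opprD addrACA subrr addr0.
Qed.

Lemma has_degree_connected (X : topologicalType) (g : X -> R[i] -> R[i]) (d : int) :
  connected [set: X] -> ccontinuous (fun tx : R * X => g tx.2 (cis tx.1)) ->
  (forall x (t : R), circle (g x (cis t))) ->
  (exists x, has_degree (g x) d) -> forall x, has_degree (g x) d.
Proof.
move=> Xc gc gcirc [x0 gx0].
have gxc x : ccontinuous (fun t : R => g x (cis t)).
  apply: (ccontinuous_comp (h := fun t : R => (t, x)) _ gc) => t.
  by apply: continuous_at_pair; [exact: cvg_id|exact: cvg_cst].
have near_pos x : \forall y \near x, forall t, 0 < Re (g y (cis t) * conjc (g x (cis t))).
  have qc : ccontinuous (fun tx : R * X => g tx.2 (cis tx.1) * conjc (g x (cis tx.1))).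
    apply: ccontinuousM => //; apply: ccontinuousJ.
    by apply: (ccontinuous_comp (h := fst) _ (gxc x)) => tx; exact: cvg_fst.
  have /compact_near_coveringP cov : compact `[(0 : R), 1] by exact: segment_compact.
  have : \forall y \near x, `[(0 : R), 1] `<=`
      (fun t => 0 < Re (g y (cis t) * conjc (g x (cis t)))).
    apply: (cov X (nbhs x)
      (fun y t => 0 < Re (g y (cis t) * conjc (g x (cis t))))) => t _.
    have /cvgr_gt := qc.1 (t, x); apply.
    by rewrite /= circle_mulJ //= ltr01.
  apply: filterS => y yP t; have [u u01 ->] := cis_frac t.
  by apply: yP; rewrite /= in_itv.
(* The real part of [h * conjc g] is symmetric in [g] and [h], so having degree [d] passes from [x]
   to [y] and back. One direction makes [A] open, the other makes its complement open, and no lift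
   at [y] is presupposed. *)
have near_iff x : \forall y \near x, has_degree (g x) d <-> has_degree (g y) d.
  apply: filterS (near_pos x) => y yP; split; apply: has_degree_near => // t.
  have := yP t; case: (g x _) (g y _) => a b [a' b'] /=; lra.
pose A := [set x | has_degree (g x) d].
have Aopen : open A.
  rewrite openE => x Ax; rewrite /interior.
  by apply: filterS (near_iff x) => y [+ _]; exact.
have Aclosed : closed A.
  rewrite -openC openE => x Ax; rewrite /interior.
  by apply: filterS (near_iff x) => y [_ xy] /xy.
have AT : A = setT.
  by apply: Xc; [exists x0|exists A => //; rewrite setTI|exists A => //; rewrite setTI].
by move=> x; have : [set: X] x by []; rewrite -AT.
Qed.

End CircleTheory.

(** * Derivatives in charts *)

Section Calculus.
Context {R : realType}.

(** In composites of maps read in charts, [cinv d \o cmap d] cancels only near the point, so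
    differentiability and differential have to be carried along local equalities. *)
Lemma near_eq_diff (V W : normedModType R) (f g : V -> W) (x : V) :
  (\forall y \near x, f y = g y) -> differentiable f x ->
  differentiable g x /\ 'd g x = 'd f x :> (V -> W).
Proof.
move=> fg df.
have fgx : f x = g x := nbhs_singleton fg.
have gE : g \o shift x = cst (g x) + 'd f x +o_ 0 id.
  have fg0 : \forall h \near (0 : V), f (h + x) = g (h + x).
    by move: fg; rewrite (near_shift 0 x) subr0.
  apply/eqaddoP => e e0; have /eqaddoP/(_ e e0) := diff_locally df.
  apply: filterS2 fg0 => h /= fgh; rewrite /= -fgx.
  by rewrite !fctE /= fgh.
have dgE : 'd g x = 'd f x :> (V -> W) by apply: diff_unique => //; exact: diff_continuous.
split => //; apply/diff_locallyP; rewrite dgE; split => //; exact: diff_continuous.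
Qed.

Lemma JacE m (f : 'cV[R]_m -> 'cV[R]_m) x i j :
  Jac f x i j = ('d f x (delta_mx j ord0 : 'cV[R]_m)) i ord0.
Proof. by rewrite /Jac mxE. Qed.

Lemma diff_Jac m (f : 'cV[R]_m -> 'cV[R]_m) x v : 'd f x v = Jac f x *m v.
Proof.
have vE : v = \sum_k v k ord0 *: (delta_mx k ord0 : 'cV[R]_m).
  by rewrite [LHS]matrix_sum_delta; apply: eq_bigr => k _; rewrite big_ord1.
apply/matrixP => i j; rewrite (ord1 j) {1}vE linear_sum summxE [RHS]mxE.
by apply: eq_bigr => k _; rewrite linearZ /= mxE JacE mulrC.
Qed.

Lemma Jac_comp m (f g : 'cV[R]_m -> 'cV[R]_m) x :
  differentiable f x -> differentiable g (f x) ->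
  Jac (g \o f) x = Jac g (f x) *m Jac f x.
Proof.
move=> df dg; apply/matrixP => i j.
have colE' (A : 'M[R]_m) : A i j = (A *m (delta_mx j ord0 : 'cV[R]_m)) i ord0.
  by rewrite -colE mxE.
apply: etrans (colE' _) (etrans _ (esym (colE' _))); congr (fun_of_matrix _ i ord0).
set v := delta_mx j ord0; rewrite -mulmxA.
have E : 'd (g \o f) x v = 'd g (f x) ('d f x v).
  exact: (congr1 (fun h => h v) (diff_comp df dg)).
have E1 := diff_Jac (g \o f) x v.
have E2 := diff_Jac f x v.
have E3 := diff_Jac g (f x) ('d f x v).
apply: etrans (esym E1) _; apply: etrans E _; apply: etrans E3 _; congr mulmx; exact: E2.
Qed.

Lemma Jac_near m (f g : 'cV[R]_m -> 'cV[R]_m) x :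
  (\forall y \near x, f y = g y) -> differentiable f x -> Jac f x = Jac g x.
Proof.
move=> fg df; have [_ E] := near_eq_diff fg df.
apply/matrixP => i j; apply: etrans (JacE _ _ _ _) (etrans _ (esym (JacE _ _ _ _))).
exact: (congr1 (fun h : 'cV[R]_m -> 'cV[R]_m => h (delta_mx j ord0) i ord0) (esym E)).
Qed.

Lemma cvg_mx (T : Type) (F : set_system T) {FF : Filter F} (a b : nat)
    (f : T -> 'M[R]_(a, b)) (A : 'M[R]_(a, b)) :
  (forall i j, f x i j @[x --> F] --> A i j) -> f x @[x --> F] --> A.
Proof.
move=> fA B [P nP PB]; apply: filterS (_ : F (fun x => forall i j, P i j (f x i j))).
  by move=> x; exact: PB.
apply: filter_forall => i; apply: filter_forall => j.
exact: (fA i j _ (nP i j)).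
Qed.

Lemma continuous_mulmx (X : topologicalType) (a b c : nat)
    (f : X -> 'M[R]_(a, b)) (g : X -> 'M[R]_(b, c)) x :
  {for x, continuous f} -> {for x, continuous g} ->
  {for x, continuous (fun y => f y *m g y)}.
Proof.
move=> fx gx; apply: cvg_mx => i j; rewrite mxE.
under eq_fun do rewrite mxE.
apply: cvg_big => [|k _]; first exact: add_continuous.
apply: cvgM.
  apply: (@continuous_comp _ _ _ f (fun A : 'M[R]_(a, b) => A i k)); first exact: fx.
  exact: coord_continuous.
apply: (@continuous_comp _ _ _ g (fun A : 'M[R]_(b, c) => A k j)); first exact: gx.
exact: coord_continuous.
Qed.

Lemma smooth_on_differentiable (U V : normedModType R) (A : set U) (f : U -> V) x :
  smooth_on A f -> A x -> differentiable f x.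
Proof. by move=> /(_ 1%N)[+ _]; exact. Qed.

Lemma smooth_on_diff_continuous (U V : normedModType R) (A : set U) (f : U -> V) v x :
  smooth_on A f -> A x -> {for x, continuous (fun y => 'd f y v)}.
Proof. by move=> /(_ 1%N)[_ /(_ v)]; exact. Qed.

End Calculus.

Section Charts.
Context {R : realType} {m : nat} {M : manifold R m}.
Implicit Types (c d e : chart R M m) (h k : M -> M) (q : M).

Lemma cimg_cmap c q : cdom c q -> cimg c (cmap c q).
Proof. exact: cmap_fun. Qed.

Lemma cdom_cinv c x : cimg c x -> cdom c (cinv c x).
Proof. exact: cinv_fun. Qed.

Lemma cmapK_dom c q : cdom c q -> cinv c (cmap c q) = q.
Proof. by move=> cq; apply: (@cmapK _ _ _ c); rewrite inE. Qed.

Lemma cinvK_img c x : cimg c x -> cmap c (cinv c x) = x.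
Proof. by move=> cx; apply: (@cinvK _ _ _ c); rewrite inE. Qed.

Lemma cmap_continuous_at c q : cdom c q -> {for q, continuous (cmap c)}.
Proof.
move=> cq; have := @cmap_continuous _ _ _ c.
by rewrite continuous_open_subspace; [apply; rewrite inE|exact: cdom_open].
Qed.

Lemma cinv_continuous_at c x : cimg c x -> {for x, continuous (cinv c)}.
Proof.
move=> cx; have := @cinv_continuous _ _ _ c.
by rewrite continuous_open_subspace; [apply; rewrite inE|exact: cimg_open].
Qed.

Lemma chart_at_atlas q : atlas (chart_at q).
Proof. by have [] := chart_atP q. Qed.

Lemma chart_at_dom q : cdom (chart_at q) q.
Proof. by have [] := chart_atP q. Qed.

(** [cmap d] is a total function with arbitrary values outside [cdom d], so differentiability of the
    representative alone would not keep [h] inside the chart; [chart_diff_near] does, and it is what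
    makes the intermediate chart cancel in the chain rule. *)
Record chart_diff c d h q : Prop := ChartDiff {
  chart_diff_dom : cdom c q;
  chart_diff_img : cdom d (h q);
  chart_diff_near : \forall x \near cmap c q, cdom d (h (cinv c x));
  chart_diff_diff : differentiable (cmap d \o h \o cinv c) (cmap c q) }.

Definition chart_der c d h q : 'M[R]_m :=
  Jac (cmap d \o h \o cinv c) (cmap c q).

Lemma chart_diff_comp c d e h k q :
  chart_diff c d h q -> chart_diff d e k (h q) -> chart_diff c e (k \o h) q.
Proof.
move=> [cq dhq nh dh] [_ ekq nk dk].
have F1q : (cmap d \o h \o cinv c) (cmap c q) = cmap d (h q).
  by rewrite /= cmapK_dom.
have F1c := differentiable_continuous dh.
have nF : \forall x \near cmap c q, cdom e (k (h (cinv c x))).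
  have : \forall x \near cmap c q, cdom e (k (cinv d ((cmap d \o h \o cinv c) x))).
    by apply: (F1c [set y | cdom e (k (cinv d y))]); rewrite F1q.
  by move=> nk'; apply: filterS2 _ nh nk' => x dx /=; rewrite cmapK_dom.
split => //.
have FE : \forall x \near cmap c q,
    ((cmap e \o k \o cinv d) \o (cmap d \o h \o cinv c)) x =
    (cmap e \o (k \o h) \o cinv c) x.
  by apply: filterS nh => x dx /=; rewrite cmapK_dom.
apply: (near_eq_diff FE _).1.
by apply: differentiable_comp; [exact: dh|rewrite F1q].
Qed.

Lemma chart_der_comp c d e h k q :
  chart_diff c d h q -> chart_diff d e k (h q) ->
  chart_der c e (k \o h) q = chart_der d e k (h q) *m chart_der c d h q.
Proof.
move=> [cq dhq nh dh] [_ ekq nk dk].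
have F1q : (cmap d \o h \o cinv c) (cmap c q) = cmap d (h q).
  by rewrite /= cmapK_dom.
have FE : \forall x \near cmap c q,
    ((cmap e \o k \o cinv d) \o (cmap d \o h \o cinv c)) x =
    (cmap e \o (k \o h) \o cinv c) x.
  by apply: filterS nh => x dx /=; rewrite cmapK_dom.
have dk' : differentiable (cmap e \o k \o cinv d) ((cmap d \o h \o cinv c) (cmap c q)).
  by rewrite F1q.
rewrite /chart_der -F1q; apply: etrans (Jac_comp dh dk').
by apply: esym; apply: Jac_near FE _; exact: differentiable_comp.
Qed.

Lemma chart_diff_id c d q : atlas c -> atlas d -> cdom c q -> cdom d q ->
  chart_diff c d id q.
Proof.
move=> ac ad cq dq; split => //.
  have := @cinv_continuous_at c (cmap c q) (cimg_cmap cq); apply.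
  by rewrite cmapK_dom //; apply: open_nbhs_nbhs; split => //; exact: cdom_open.
by apply: smooth_on_differentiable (atlas_smooth ac ad) _; exists q.
Qed.

Lemma chart_der_id c q : cdom c q -> chart_der c c id q = 1%:M.
Proof.
move=> cq; have cx := cimg_cmap cq.
have E : \forall x \near cmap c q, id x = (cmap c \o id \o cinv c) x.
  apply: filterS (open_nbhs_nbhs (conj (@cimg_open _ _ _ c) cx)) => x cimgx /=.
  by rewrite cinvK_img.
have did : differentiable (id : 'cV[R]_m -> 'cV[R]_m) (cmap c q) by [].
apply: etrans (esym (Jac_near E did)) _.
apply/matrixP => i j; apply: etrans (JacE _ _ _ _) _.
by rewrite diff_val !mxE eqxx andbT.
Qed.

Lemma dmapE h p : dmap h p = chart_der (chart_at p) (chart_at (h p)) h p.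
Proof. by []. Qed.

Lemma to_chartE c q : to_chart c q = chart_der (chart_at q) c id q.
Proof. by []. Qed.

Lemma from_chartE c q : cdom c q ->
  from_chart c (cmap c q) = chart_der c (chart_at q) id q.
Proof. by move=> cq; rewrite /from_chart cmapK_dom. Qed.

Lemma to_from_chart c d q : atlas c -> atlas d -> cdom c q -> cdom d q ->
  to_chart d q *m from_chart c (cmap c q) = chart_der c d id q.
Proof.
move=> ac ad cq dq; rewrite from_chartE // to_chartE.
have aq := chart_at_atlas q; have qq := chart_at_dom q.
apply: esym; apply: (@chart_der_comp c (chart_at q) d id id q).
  exact: chart_diff_id.
exact: chart_diff_id.
Qed.

Lemma from_to_chart c q : atlas c -> cdom c q ->
  from_chart c (cmap c q) *m to_chart c q = 1%:M.
Proof.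
move=> ac cq; have aq := chart_at_atlas q; have qq := chart_at_dom q.
rewrite from_chartE // to_chartE -(chart_der_id qq).
apply: esym; apply: (@chart_der_comp (chart_at q) c (chart_at q) id id q);
  exact: chart_diff_id.
Qed.

(** Replaces the preferred charts, which change with [q] without any continuity, by fixed ones. Only
    in this form can continuity of the differential in [q] be proved. *)
Lemma dmap_chart c d h q : atlas c -> atlas d -> chart_diff c d h q ->
  dmap h q = from_chart d (cmap d (h q)) *m chart_der c d h q *m to_chart c q.
Proof.
move=> ac ad hq; have [cq dhq _ _] := hq.
have aq := chart_at_atlas q; have qq := chart_at_dom q.
have ahq := chart_at_atlas (h q); have hqq := chart_at_dom (h q).
rewrite from_chartE // to_chartE dmapE -mulmxA.
have d1 : chart_diff (chart_at q) c id q by exact: chart_diff_id.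
have d2 : chart_diff d (chart_at (h q)) id (h q) by exact: chart_diff_id.
apply: etrans (congr1 (mulmx _) (@chart_der_comp _ _ _ id h q d1 hq)).
exact: (@chart_der_comp _ _ _ h id q (chart_diff_comp d1 hq) d2).
Qed.

Lemma dmap_comp h k p :
  chart_diff (chart_at p) (chart_at (h p)) h p ->
  chart_diff (chart_at (h p)) (chart_at (k (h p))) k (h p) ->
  dmap (k \o h) p = dmap k (h p) *m dmap h p.
Proof. exact: chart_der_comp. Qed.

End Charts.

(** * Frames and the circle action *)

Section FrameTopology.
Context {R : realType} {m : nat} {M : manifold R m}.
Implicit Types (c d e : chart R M m) (q : M).

Lemma continuous_at_near_eq (X Y : topologicalType) (f g : X -> Y) x :
  (\forall y \near x, g y = f y) -> {for x, continuous g} -> {for x, continuous f}.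
Proof.
move=> fg gx A; rewrite -(nbhs_singleton fg) => /gx gA.
by apply: filterS2 _ fg gA => y /= ->.
Qed.

Lemma diff_coord_continuous (U : normedModType R) (a : nat) (A : set U) (f : U -> 'cV[R]_a) v i x :
  smooth_on A f -> A x -> {for x, continuous (fun y => ('d f y v) i ord0)}.
Proof.
move=> fs Ax.
apply: (@continuous_comp _ _ _ (fun y => 'd f y v) (fun A : 'cV[R]_a => A i ord0)).
  exact: smooth_on_diff_continuous fs Ax.
exact: coord_continuous.
Qed.

Lemma Jac_continuous (A : set 'cV[R]_m) (f : 'cV[R]_m -> 'cV[R]_m) x :
  smooth_on A f -> A x -> {for x, continuous (Jac f)}.
Proof.
move=> fs Ax; apply: (@cvg_mx _ _ (nbhs x)) => i j.
under eq_fun do rewrite JacE; rewrite JacE.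
exact: (diff_coord_continuous (v := (delta_mx j ord0 : 'cV[R]_m)) (i := i) fs Ax).
Qed.

(** Openness in [frames] is tested in every chart [c'] of the atlas. Read there, the coordinates in
    [c] are [(y, F) |-> (tr y, Jac tr y *m F)] with [tr] the transition map, and smoothness of [tr]
    makes this continuous. *)
Lemma fcoord_continuous c (f0 : frames M) : atlas c -> cdom c f0.1 ->
  {for f0, continuous (fcoord c)}.
Proof.
move=> ac cf0 B; rewrite nbhsE => -[B0 [oB0 B0f0] B0B].
pose W : set (frames M) := [set f | cdom c f.1 /\ B0 (fcoord c f)].
suff oW : frames_open W.
  by rewrite nbhs_simpl nbhsE; exists W => // f [_ ?]; exact: B0B.
move=> c' ac'; rewrite openE => -[x F] /= [c'x [cq B0q]].
set q := cinv c' x in cq B0q.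
have c'q : cdom c' q by exact: cdom_cinv.
have xE : x = cmap c' q by rewrite cinvK_img.
pose tr := cmap c \o cinv c'.
have TE y : cimg c' y -> cdom c (cinv c' y) -> to_chart c (cinv c' y) *m from_chart c' y = Jac tr y.
  move=> c'y cy; have h := to_from_chart ac' ac (cdom_cinv c'y) cy.
  rewrite (cinvK_img c'y) in h; apply: etrans h _.
  by rewrite /chart_der (cinvK_img c'y).
have near_img : \forall yG \near (x, F), cimg c' yG.1.
  apply: (cvg_fst (F := nbhs x) (G := nbhs F)).
  by apply: open_nbhs_nbhs; split => //; exact: cimg_open.
have near_dom : \forall yG \near (x, F), cdom c (cinv c' yG.1).
  apply: (@cvg_fst _ _ (nbhs x) (nbhs F) _ [set y | cdom c (cinv c' y)]).
  have cc := cinv_continuous_at c'x; apply: (cc (cdom c)).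
  by apply: open_nbhs_nbhs; split => //; exact: cdom_open.
have trc : {for x, continuous tr}.
  apply: (@continuous_comp _ _ _ (cinv c') (cmap c)); first exact: cinv_continuous_at.
  exact: cmap_continuous_at.
have Jc : {for x, continuous (Jac tr)}.
  by apply: Jac_continuous (atlas_smooth ac' ac) _; exists q.
pose G (yG : 'cV[R]_m * 'M[R]_m) := (tr yG.1, Jac tr yG.1 *m yG.2).
have Gc : {for (x, F), continuous G}.
  apply: continuous_at_pair.
    by apply: (@continuous_comp _ _ _ fst tr); [exact: cvg_fst|exact: trc].
  apply: continuous_mulmx; last exact: cvg_snd.
  by apply: (@continuous_comp _ _ _ fst (Jac tr)); [exact: cvg_fst|exact: Jc].
have near_B0 : \forall yG \near (x, F), B0 (G yG).
  apply: (Gc B0); apply: open_nbhs_nbhs; split => //.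
  by rewrite /G /= -TE // -mulmxA.
rewrite /interior.
apply: filterS3 _ near_img near_dom near_B0 => -[y H] /= c'y cy B0y; split => //; split => //.
by rewrite /fcoord /= mulmxA TE.
Qed.

Lemma frame_of_coord_continuous d (xF : 'cV[R]_m * 'M[R]_m) : atlas d ->
  cimg d xF.1 ->
  {for xF, continuous (fun yG : 'cV[R]_m * 'M[R]_m =>
     (cinv d yG.1, from_chart d yG.1 *m yG.2) : frames M)}.
Proof.
move=> ad dx B; rewrite nbhsE => -[B0 [oB0 B0x] B0B].
have oS := (oB0 : frames_open B0) d ad.
rewrite nbhs_simpl nbhsE; eexists; first by split; [exact: oS|split; [exact: dx|exact: B0x]].
by move=> yG [_ ?]; exact: B0B.
Qed.

Lemma frame_base_continuous : continuous (fst : frames M -> M).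
Proof.
apply/continuousP => A oA; suff : frames_open (fst @^-1` A) by [].
move=> c ac; rewrite openE => -[x F] /= [cx Ax].
have cc := cinv_continuous_at cx.
have near_cimg : \forall y \near x, cimg c y.
  by apply: open_nbhs_nbhs; split => //; exact: cimg_open.
have near_A : \forall y \near x, A (cinv c y).
  by apply: (cc A); exact: open_nbhs_nbhs.
rewrite /interior.
apply: (@cvg_fst _ _ (nbhs x) (nbhs F) _ [set y | cimg c y /\ A (cinv c y)]).
by apply: filterS2 _ near_cimg near_A.
Qed.

Lemma fmul_continuous (C : 'M[R]_m) : continuous (fun f : frames M => fmul f C).
Proof.
apply/continuousP => W oW; have {}oW : frames_open W := oW.
suff : frames_open ((fun f => fmul f C) @^-1` W) by [].
move=> c ac.
pose h (xF : 'cV[R]_m * 'M[R]_m) := (xF.1, xF.2 *m C).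
have hc : continuous h.
  move=> xF; apply: continuous_at_pair; first exact: cvg_fst.
  by apply: continuous_mulmx; [exact: cvg_snd|exact: cvg_cst].
move/continuousP : hc => /(_ _ (oW c ac)); congr open.
by apply/seteqP; split => xF /=; rewrite /fmul /= mulmxA.
Qed.

End FrameTopology.

Section ActionTopology.
Context {R : realType} {m : nat} {M : manifold R m} {om : symplectic_form M}.
Variable Phi : symplectic_circle_action om.

(** [D] is the partial differential in [x] of the action read in charts as a function of both
    variables. Taking it from the joint differential gives continuity in [(t, x)] together, which
    the Jacobians of the separate maps [Phi (cis t)] would not provide. *)
Lemma action_chart (t0 : R) (p0 : M) :
  let c := chart_at p0 in let d := chart_at (Phi (cis t0) p0) in
  exists (V : set (R^o * 'cV[R]_m)%type) (D : R^o * 'cV[R]_m -> 'M[R]_m),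
    [/\ open V, V (t0, cmap c p0),
      forall t q, cdom c q -> V (t, cmap c q) ->
        chart_diff c d (Phi (cis t)) q /\ chart_der c d (Phi (cis t)) q = D (t, cmap c q),
      forall tx, V tx -> {for tx, continuous D} &
      forall tx, V tx ->
        {for tx, continuous (fun tx => cmap d (Phi (cis tx.1) (cinv c tx.2)))}].
Proof.
move=> c d; have [V [oV Vp VP sV]] := phi_smooth Phi t0 p0.
pose psi (tx : R^o * 'cV[R]_m) := cmap d (Phi (cis tx.1) (cinv c tx.2)).
pose D (tx : R^o * 'cV[R]_m) : 'M[R]_m :=
  \matrix_(i, j) ('d psi tx (0 : R^o, delta_mx j ord0 : 'cV[R]_m)) i ord0.
exists V, D; split; [exact: oV|exact: Vp| | |].
- move=> t q cq Vq.
  (* Inclusion of the slice at time [t]. Its differential is [v |-> (0, v)], so the chain rule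
     identifies the Jacobian of [Phi (cis t)] with [D]. *)
  pose inc (x : 'cV[R]_m) : R^o * 'cV[R]_m := (t : R^o, x).
  have dcst : differentiable (cst (t : R^o) : 'cV[R]_m -> R^o) (cmap c q) by [].
  have dmid : differentiable (id : 'cV[R]_m -> 'cV[R]_m) (cmap c q) by [].
  have dinc : differentiable inc (cmap c q) by exact: differentiable_pair.
  have dpsi : differentiable psi (inc (cmap c q)).
    exact: smooth_on_differentiable sV Vq.
  have nV : \forall x \near cmap c q, V (t, x).
    have := differentiable_continuous dinc; apply.
    by apply: open_nbhs_nbhs.
  split.
    split => //.
    - by have [_] := VP _ _ Vq; rewrite cmapK_dom.
    - by apply: filterS nV => x /VP[].
    - exact: differentiable_comp dinc dpsi.
  apply/matrixP => i j; apply: etrans (JacE _ _ _ _) _; rewrite mxE.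
  have E := diff_comp dinc dpsi.
  apply: etrans (congr1 (fun h : 'cV[R]_m -> 'cV[R]_m => h (delta_mx j ord0) i ord0) E) _.
  have Einc (v : 'cV[R]_m) : 'd inc (cmap c q) v = (0 : R^o, v).
    apply: etrans (congr1 (fun h => h v) (diff_pair dcst dmid)) _.
    by congr pair; rewrite ?diff_cst // diff_val.
  exact: (congr1 (fun w => ('d psi (inc (cmap c q)) w) i ord0) (Einc _)).
- move=> tx Vtx; 
  suff Dij i j : {for tx, continuous (fun tx => D tx i j)} by exact: cvg_mx Dij.
  apply: continuous_at_near_eq (_ : {for tx, continuous (fun tx =>
    ('d psi tx (0 : R^o, delta_mx j ord0 : 'cV[R]_m)) i ord0)}).
    by near=> y; rewrite mxE.
  exact: (diff_coord_continuous (v := (0 : R^o, delta_mx j ord0 : 'cV[R]_m)) (i := i) sV Vtx).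
- move=> tx Vtx; apply: differentiable_continuous.
  exact: smooth_on_differentiable sV Vtx.
Unshelve. all: by end_near. Qed.

Lemma action_chart_diff (z : R[i]) (p : M) : circle z ->
  chart_diff (chart_at p) (chart_at (Phi z p)) (Phi z) p.
Proof.
move=> /circle_cis_surj[t ->]; have [V [D [_ Vp VP _ _]]] := action_chart t p.
by have [] := VP t p (chart_at_dom p) Vp.
Qed.

Lemma dmap_action (z z' : R[i]) (p : M) : circle z -> circle z' ->
  dmap (Phi (z * z')) p = dmap (Phi z) (Phi z' p) *m dmap (Phi z') p.
Proof.
move=> cz cz'; have -> : phi Phi (z * z') = phi Phi z \o phi Phi z'.
  by apply/funext => q /=; rewrite phiM.
exact: dmap_comp (action_chart_diff p cz') (action_chart_diff (Phi z' p) cz).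
Qed.

(* In the charts of [action_chart] the push-forward of frames is
   [(t, x, F) |-> (psi (t, x), D (t, x) *m F)], with [D] the partial differential of
   [psi] in [x]. *)
Lemma fpush_action_continuous :
  continuous (fun tf : R * frames M => fpush (Phi (cis tf.1)) tf.2).
Proof.
move=> [t0 f0]; set p0 := f0.1.
have [V [D [oV Vp VP Dc psic]]] := action_chart t0 p0.
set c := chart_at p0 in Vp VP psic; set d := chart_at (Phi (cis t0) p0) in VP psic.
have ac : atlas c := chart_at_atlas p0.
have ad : atlas d := chart_at_atlas (Phi (cis t0) p0).
have cp : cdom c p0 := chart_at_dom p0.
pose psi (tx : R^o * 'cV[R]_m) := cmap d (Phi (cis tx.1) (cinv c tx.2)).
pose co (tf : R * frames M) : R^o * 'cV[R]_m := (tf.1, (fcoord c tf.2).1).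
have fc : {for (t0, f0), continuous (fun tf : R * frames M => fcoord c tf.2)}.
  apply: (@continuous_comp _ _ _ snd (fcoord c)); first exact: cvg_snd.
  exact: fcoord_continuous.
have coc : {for (t0, f0), continuous co}.
  apply: continuous_at_pair; first exact: cvg_fst.
  apply: (@continuous_comp _ _ _ (fun tf : R * frames M => fcoord c tf.2) fst).
    exact: fc.
  exact: cvg_fst.
pose g tf : 'cV[R]_m * 'M[R]_m := (psi (co tf), D (co tf) *m (fcoord c tf.2).2).
have gc : {for (t0, f0), continuous g}.
  apply: continuous_at_pair.
    by apply: (@continuous_comp _ _ _ co psi); [exact: coc|exact: psic].
  apply: continuous_mulmx.
    by apply: (@continuous_comp _ _ _ co D); [exact: coc|exact: Dc].
  apply: (@continuous_comp _ _ _ (fun tf : R * frames M => fcoord c tf.2) snd).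
    exact: fc.
  exact: cvg_snd.
have nV : \forall tf \near (t0, f0), V (co tf).
  by apply: (coc V); exact: open_nbhs_nbhs.
have ncd : \forall tf \near (t0, f0), cdom c tf.2.1.
  apply: (@cvg_snd _ _ (nbhs t0) (nbhs f0) _ [set f | cdom c f.1]).
  have h : {for f0, continuous (fst : frames M -> M)} by exact: frame_base_continuous.
  apply: (h (cdom c)).
  by apply: open_nbhs_nbhs; split => //; exact: cdom_open.
pose k (yG : 'cV[R]_m * 'M[R]_m) : frames M := (cinv d yG.1, from_chart d yG.1 *m yG.2).
have kg : {for (t0, f0), continuous (fun tf => k (g tf))}.
  apply: (@continuous_comp _ _ _ g k); first exact: gc.
  apply: frame_of_coord_continuous => //.
  have [pd _] := VP _ _ cp Vp.
  by rewrite /g /psi /co /= cmapK_dom //; apply/cimg_cmap/chart_diff_img/pd.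
apply: continuous_at_near_eq kg.
apply: filterS2 _ nV ncd => -[t f] /= Vf cf.
have [pd pder] := VP t f.1 cf Vf.
rewrite /k /g /psi /co /= (cmapK_dom cf) (cmapK_dom (chart_diff_img pd)).
rewrite /fpush (dmap_chart ac ad pd) pder.
by rewrite -!mulmxA.
Qed.

End ActionTopology.

(** * The Maslov bundle *)

Section UnitaryFrames.
Context {R : realType} {n : nat} {M : manifold R (n + n)}.
Variables (om : symplectic_form M) (J : M -> 'M[R]_(n + n)).
Hypothesis J_compatible : compatible om J.
Implicit Types (U V : 'M[R[i]]_n) (f : ufr om J).

Lemma realify_adj U : realify (map_mx (@Num.conj R[i]) U^T) = (realify U)^T.
Proof.
rewrite /realify tr_block_mx; congr block_mx; apply/matrixP => i j; rewrite !mxE;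
  by case: (U j i) => a b /=; rewrite ?opprK.
Qed.

Lemma realify_unitary U : U \is unitarymx -> (realify U)^T *m realify U = 1%:M.
Proof.
by move=> /unitarymxP uU; apply: mulmx1C; rewrite -realify_adj -realifyM uU realify1.
Qed.

Lemma gramE p : gram om J p = (J p)^T *m om p.
Proof. by []. Qed.

Lemma omega_acs p : (omega om p : 'M[R]_(n + n)) *m J p = - gram om J p.
Proof.
rewrite -(gram_sym J_compatible) gramE trmx_mul omega_alt trmxK mulNmx.
by rewrite opprK.
Qed.

(** Serves for the block of the [v_i]: as [v = - J u], their orthonormality reduces to that of the
    [u_i]. *)
Lemma gram_acs p : (J p)^T *m gram om J p *m J p = gram om J p.
Proof.
rewrite [in LHS]gramE -!mulmxA omega_acs !mulmxN mulmxA -trmx_mul.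
by rewrite (acs_square J_compatible) linearN /= trmx1 mulNmx mul1mx opprK.
Qed.

(* With [v = - J u], the two conditions on [u] and [v] say that the whole frame is
   [g_J]-orthonormal. *)
Lemma unitary_frameE (p : M) (F : 'M[R]_(n + n)) :
  unitary_frame om J (p, F) <->
  rsubmx F = - (J p *m lsubmx F) /\ F^T *m gram om J p *m F = 1%:M.
Proof.
set u := lsubmx F; set v := rsubmx F; set g := gram om J p.
have FE : F = row_mx u v by rewrite hsubmxK.
have gT : g^T = g := gram_sym J_compatible p.
have GE : F^T *m g *m F =
    block_mx (u^T *m g *m u) (u^T *m g *m v) (v^T *m g *m u) (v^T *m g *m v).
  by rewrite FE tr_row_mx mul_col_mx mul_col_row.
split.
  move=> [/= _ vE uu uv]; split => //; rewrite GE uu uv.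
  have -> : v^T *m g *m u = 0.
    apply: trmx_inj; rewrite trmx0 trmx_mul (trmx_mul v^T) trmxK gT mulmxA.
    exact: uv.
  have -> : v^T *m g *m v = 1%:M.
    have vE' : v = - (J p *m u) := vE.
    have vT : v^T = - (u^T *m (J p)^T) by rewrite vE' linearN /= trmx_mul.
    rewrite vT vE' !mulNmx mulmxN opprK -uu -(gram_acs p) -/g.
    by rewrite !mulmxA.
  by rewrite -scalar_mx_block.
move=> [vE GF]; move: (GF); rewrite GE (scalar_mx_block n n) => /eq_block_mx[uu uv _ _].
split => //=.
have /mulmx1_unit[_ //] := GF.
Qed.

(** [realify U] is orthogonal, which keeps the Gram matrix, and its block form is that of a complex
    linear map, which keeps [v = - J u]. *)
Lemma unitary_frame_mul (p : M) (F : 'M[R]_(n + n)) U : U \is unitarymx ->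
  unitary_frame om J (p, F) -> unitary_frame om J (p, F *m realify U).
Proof.
move=> uU /unitary_frameE[vE GF]; apply/unitary_frameE; split.
  rewrite -[F]hsubmxK /realify mul_row_block row_mxKr row_mxKl vE.
  set u := lsubmx F; set A := map_mx _ U; set B := map_mx _ U.
  rewrite !mulNmx mulmxDr !mulmxN !mulmxA (acs_square J_compatible).
  by rewrite !mulNmx mul1mx opprK opprD addrC.
move: (gram om J p) GF => g GF; rewrite trmx_mul.
have -> : (realify U)^T *m F^T *m g *m (F *m realify U) =
    (realify U)^T *m (F^T *m g *m F) *m realify U by rewrite !mulmxA.
by rewrite GF mulmx1 realify_unitary.
Qed.

Lemma ufrP f : unitary_frame om J (set_val f).
Proof. exact: set_valP. Qed.

Lemma ufr_ex (F : frames M) : unitary_frame om J F -> exists f : ufr om J, set_val f = F.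
Proof. by move=> uF; exists (SigSub (mem_set uF)). Qed.

Lemma ufr_inj f f' : set_val f = set_val f' -> f = f'.
Proof. exact: val_inj. Qed.

Lemma ufr_mul_ex f U : U \is unitarymx -> exists f', ufr_mul f U f'.
Proof.
move=> uU; apply: ufr_ex; have := ufrP f; rewrite /fmul.
by case: (set_val f) => p F; exact: unitary_frame_mul.
Qed.

Lemma frame_class_surj (w : maslov_bundle om J) : exists f, frame_class f = w.
Proof. by exists (repr w); exact: reprK. Qed.

Lemma frame_classP f f' : frame_class f = frame_class f' <-> exists2 U, in_EU U & ufr_mul f U f'.
Proof.
split=> [/eqquotP/asboolP//|ff']; apply/eqquotP; exact/asboolP.
Qed.

Lemma bundle_proj_class f : bundle_proj (frame_class f) = ufr_base f.
Proof.
have /frame_classP[U _ ff'] : frame_class (repr (frame_class f)) = frame_class f.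
  exact: reprK.
by rewrite /bundle_proj /ufr_base ff'.
Qed.

Lemma ufr_mulA f f' f'' U V : ufr_mul f U f' -> ufr_mul f' V f'' -> ufr_mul f (U *m V) f''.
Proof. by rewrite /ufr_mul => -> ->; rewrite /fmul /= realifyM mulmxA. Qed.

Lemma ufr_mulV f f' U : U \is unitarymx -> ufr_mul f U f' -> ufr_mul f' (invmx U) f.
Proof.
move=> uU; rewrite /ufr_mul => ->; rewrite /fmul /= -mulmxA -realifyM mulmxV.
  by rewrite realify1 mulmx1; case: (set_val f).
exact: unitarymx_unit.
Qed.

Lemma unitarymxV U : U \is unitarymx -> invmx U \is unitarymx.
Proof. by move=> uU; rewrite (invmx_unitary uU) trmxC_unitary. Qed.

(** Well-definedness of the inherent action. If [xget] picked another representative and a unitary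
    [V], the two results differ by [invmx V *m (E *m U)]; equal squares give [\det U = \det V] or
    [\det U = - \det V], so this matrix lies in the group of determinant 1 or -1. *)
Lemma inherent_actE f U f' z : U \is unitarymx -> \det U ^+ 2 = z ->
  ufr_mul f U f' -> inherent_act (frame_class f) z = frame_class f'.
Proof.
move=> uU dU ff'; rewrite /inherent_act; case: xgetP => [w' -> |/(_ (frame_class f'))]; last first.
  by case; exists f, f', U.
move=> [f1 [f1' [V [e1 -> uV dV f1V]]]].
have /frame_classP[E [uE dE] fE] := esym e1.
apply/frame_classP; exists (invmx V *m (E *m U)).
  split; first exact: mul_unitarymx (unitarymxV uV) (mul_unitarymx uE uU).
  have dV0 : \det V != 0 by rewrite -unitfE -unitmxE unitarymx_unit.
  rewrite !det_mulmx det_inv.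
  have : (\det U - \det V) * (\det U + \det V) = 0 by rewrite -subr_sqr dU dV subrr.
  move=> /eqP; rewrite mulf_eq0 subr_eq0 addr_eq0 => UV.
  by case/orP: UV => /eqP ->; case: dE => ->;
    rewrite ?mul1r ?mulN1r ?mulrN ?opprK ?mulVf //; [left|right|right|left].
apply: ufr_mulA (ufr_mulV uV f1V) _; exact: ufr_mulA fE ff'.
Qed.

Lemma ufr_mul_continuous U (h : ufr om J -> ufr om J) :
  (forall f, ufr_mul f U (h f)) -> continuous h.
Proof.
move=> hU; apply: (@continuous_comp_initial _ _ _ set_val h).
have -> : set_val \o h = (fun F => fmul F (realify U)) \o set_val.
  by apply/funext => f; exact: hU.
move=> f; apply: continuous_comp; last exact: fmul_continuous.
exact: initial_continuous.
Qed.

(** The saturation of [W] is the union of its translates by the matrices satisfying [in_EU], each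
    open because right multiplication is continuous. *)
Lemma frame_class_open (W : set (ufr om J)) : open W -> open (@frame_class R n M om J @` W).
Proof.
move=> oW.
suff : open (@frame_class R n M om J @^-1` (@frame_class R n M om J @` W)) by [].
rewrite (_ : _ @^-1` _ = \bigcup_(U in [set U | in_EU U])
    [set f | exists2 f', ufr_mul f U f' & W f']); last first.
  apply/seteqP; split => [f [f' Wf' /esym/frame_classP[U UE ff']]|f [U UE [f' ff' Wf']]].
    by exists U => //; exists f'.
  by exists f' => //; apply/esym/frame_classP; exists U.
apply: bigcup_open => U [uU _].
have [h hU] := choice (fun f => ufr_mul_ex f uU).
rewrite (_ : [set _ | _] = h @^-1` W).
  by apply: open_comp => // f _; exact: (ufr_mul_continuous hU).
apply/seteqP; split => [f [f' ff' Wf']|f Wf]; last by exists (h f).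
by rewrite /= (_ : h f = f') //; apply: ufr_inj; rewrite ff' (hU f).
Qed.

Lemma frame_class_continuous : continuous (@frame_class R n M om J).
Proof. exact: pi_continuous. Qed.

End UnitaryFrames.

(** * Explicit unitary matrices with prescribed squared determinant *)

Section UnitaryRotation.
Context {R : realType} {n : nat}.

Lemma realifyD (U V : 'M[R[i]]_n) : realify (U + V) = realify U + realify V.
Proof.
rewrite /realify add_block_mx; congr block_mx; apply/matrixP => i j;
  by rewrite !mxE; case: (U i j) (V i j) => a b [a' b'] //=; rewrite opprD.
Qed.

Lemma realifyZ (x : R) (U : 'M[R[i]]_n) : realify ((x%:C)%C *: U) = x *: realify U.
Proof.
rewrite /realify scale_block_mx; congr block_mx; apply/matrixP => i j;
  by rewrite !mxE; case: (U i j) => a b /=; rewrite ?mul0r ?subr0 ?addr0 ?mulrN.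
Qed.

(* Half the angle [u], since [inherent_act] goes by the square of the determinant. *)
Definition half_rotation (u : R) : 'M[R[i]]_n :=
  diag_mx (\row_j if j == 0%N :> nat then cis (u / 2) else 1).

Lemma half_rotation_unitary u : half_rotation u \is unitarymx.
Proof.
apply/unitarymxP; rewrite /half_rotation tr_diag_mx map_diag_mx mulmx_diag -diag_const_mx.
congr diag_mx; apply/rowP => j; rewrite !mxE; case: ifP => _.
  by rewrite circle_mulJ //; exact: circle_cis.
by rewrite mul1r rmorph1.
Qed.

Lemma half_rotation_det u : (0 < n)%N -> \det (half_rotation u) ^+ 2 = cis u.
Proof.
move=> n0; rewrite det_diag (bigD1 (Ordinal n0)) //= mxE eqxx big1 ?mulr1.
  by rewrite expr2 -cisD -splitr.
by move=> j; rewrite -val_eqE /= mxE => /negPf ->.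
Qed.

(** Only one diagonal entry depends on [u], through the angle [pi * u]. This affine form in cosine
    and sine makes the orbit of a frame visibly differentiable. *)
Lemma half_rotation_realify :
  exists X0 X1 X2 : 'M[R]_(n + n), forall u,
    realify (half_rotation u) = X0 + cos (pi * u) *: X1 + sin (pi * u) *: X2.
Proof.
pose D0 : 'M[R[i]]_n := diag_mx (\row_j if j == 0%N :> nat then 0 else 1).
pose D1 : 'M[R[i]]_n := diag_mx (\row_j if j == 0%N :> nat then 1 else 0).
pose D2 : 'M[R[i]]_n := diag_mx (\row_j if j == 0%N :> nat then 'i%C else 0).
exists (realify D0), (realify D1), (realify D2) => u.
rewrite -!realifyZ -!realifyD; congr realify.
have piE : 2 * pi * (u / 2) = pi * u :> R by field.
apply/matrixP => i j; rewrite !mxE; case: (i == j); last by rewrite !mulr0n !mulr0 !addr0.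
rewrite !mulr1n; case: ifP => _; last by rewrite !mulr0 !addr0.
by rewrite /cis piE; apply: complex_ext => /=; ring.
Qed.

End UnitaryRotation.

(** * The angle coordinate of a trivialized Maslov bundle *)

Section Trivialization.
Context {R : realType} {n : nat} {M : manifold R (n + n)}.
Variables (om : symplectic_form M) (J : M -> 'M[R]_(n + n)).
Local Notation Gamma := (maslov_bundle om J).
Variables (T : Gamma -> M * R[i]^o) (S : M * R[i]^o -> Gamma).
Hypothesis T_continuous : continuous T.
Hypothesis TK : forall w, S (T w) = w.
Hypothesis SK : forall x, circle x.2 -> T (S x) = x.
Hypothesis T_equivariant : forall w, [/\ (T w).1 = bundle_proj w, circle (T w).2 &
  forall z : R[i], circle z -> T (inherent_act w z) = ((T w).1, (T w).2 * z)].

Implicit Types (w : Gamma) (z : R[i]).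

Lemma triv_base w : (T w).1 = bundle_proj w.
Proof. by have [] := T_equivariant w. Qed.

Lemma triv_circle w : circle (T w).2.
Proof. by have [] := T_equivariant w. Qed.

Lemma triv_inj w w' : bundle_proj w = bundle_proj w' -> (T w).2 = (T w').2 -> w = w'.
Proof.
rewrite -!triv_base => e1 e2; rewrite -[w]TK -[w']TK; congr S.
by case: (T w) (T w') e1 e2 => a b [a' b'] /= -> ->.
Qed.

Lemma triv_act w z : circle z -> (T (inherent_act w z)).2 = (T w).2 * z.
Proof. by move=> cz; have [_ _ ->] := T_equivariant w. Qed.

Lemma proj_act w z : circle z -> bundle_proj (inherent_act w z) = bundle_proj w.
Proof. by move=> cz; rewrite -!triv_base; have [_ _ ->] := T_equivariant w. Qed.

Lemma inherent_actM w z z' : circle z -> circle z' ->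
  inherent_act (inherent_act w z) z' = inherent_act w (z * z').
Proof.
move=> cz cz'; apply: triv_inj; first by rewrite !proj_act //; exact: circleM.
by rewrite !triv_act ?mulrA //; exact: circleM.
Qed.

Lemma fibre_act w w' : bundle_proj w = bundle_proj w' ->
  w' = inherent_act w ((T w').2 * conjc (T w).2).
Proof.
have cw := triv_circle w; have cw' := triv_circle w'.
have cc := circleM cw' (circleJ cw) => pw.
apply: triv_inj; first by rewrite proj_act.
by rewrite triv_act // mulrCA circle_mulJ ?mulr1.
Qed.

Lemma Re_continuous : continuous (@complex.Re R : R[i]^o -> R).
Proof.
move=> z A /nbhs_ballP[e e0 eA]; apply/nbhs_ballP.
exists (e%:C)%C; first by rewrite /= ltcR.
move=> y zy; apply: eA; move: zy; rewrite /ball /= normc_def ltcR; apply: le_lt_trans.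
rewrite -sqrtr_sqr; apply: ler_wsqrtr.
by case: z y => a b [a' b'] /=; rewrite lerDl sqr_ge0.
Qed.

Lemma Im_continuous : continuous (@complex.Im R : R[i]^o -> R).
Proof.
move=> z A /nbhs_ballP[e e0 eA]; apply/nbhs_ballP.
exists (e%:C)%C; first by rewrite /= ltcR.
move=> y zy; apply: eA; move: zy; rewrite /ball /= normc_def ltcR; apply: le_lt_trans.
rewrite -sqrtr_sqr; apply: ler_wsqrtr.
by case: z y => a b [a' b'] /=; rewrite lerDr sqr_ge0.
Qed.

Lemma triv_angle_continuous : ccontinuous (fun w => (T w).2).
Proof.
have Tc w : {for w, continuous (fun w => (T w).2)}.
  by apply: (@continuous_comp _ _ _ T snd); [exact: T_continuous|exact: cvg_snd].
split=> w.
  by apply: (@continuous_comp _ _ _ (fun w => (T w).2) (@complex.Re R : R[i]^o -> R));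
    [exact: Tc|exact: Re_continuous].
by apply: (@continuous_comp _ _ _ (fun w => (T w).2) (@complex.Im R : R[i]^o -> R));
    [exact: Tc|exact: Im_continuous].
Qed.

Lemma bundle_proj_continuous : continuous (@bundle_proj R n M om J).
Proof.
rewrite (_ : @bundle_proj R n M om J = fst \o T); last first.
  by apply/funext => w /=; rewrite triv_base.
by move=> w; apply: continuous_comp; [exact: T_continuous|exact: cvg_fst].
Qed.

(** Both [w] and [s (bundle_proj w)] lie in one fibre, so the quotient of their angles moves the
    second to the first. Hence [xget] never falls back on its default, and equivariance shows that
    its choice is unique. *)
Lemma tr_sectionE (s : M -> Gamma) w : global_section s ->
  (tr_section s w).2 = (T w).2 * conjc (T (s (bundle_proj w))).2.
Proof.
move=> [_ sP]; set w0 := s (bundle_proj w).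
have pw0 : bundle_proj w0 = bundle_proj w by rewrite sP.
have cw := triv_circle w; have cw0 := triv_circle w0.
rewrite /tr_section /=; case: xgetP => [z -> [cz wE]|/(_ ((T w).2 * conjc (T w0).2))].
  have := congr1 (fun w => (T w).2) wE; rewrite triv_act // => ->.
  by rewrite mulrAC circle_mulJ ?mul1r.
case; split; first by apply: circleM => //; exact: circleJ.
exact: fibre_act.
Qed.

Lemma tr_section_continuous (s : M -> Gamma) : global_section s ->
  ccontinuous (fun w => (tr_section s w).2).
Proof.
move=> sP; have [sc _] := sP.
rewrite (_ : (fun w => _) = (fun w => (T w).2 * conjc (T (s (bundle_proj w))).2)); last first.
  by apply/funext => w; exact: tr_sectionE.
apply: ccontinuousM; first exact: triv_angle_continuous.
apply: ccontinuousJ.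
apply: (ccontinuous_comp (h := fun w => s (bundle_proj w)) _ triv_angle_continuous) => w.
apply: continuous_comp; [exact: bundle_proj_continuous|exact: sc].
Qed.

Lemma tr_section_circle (s : M -> Gamma) w : global_section s -> circle (tr_section s w).2.
Proof.
by move=> sP; rewrite tr_sectionE //; apply: circleM; [|apply: circleJ]; exact: triv_circle.
Qed.

Lemma tr_section_act (s : M -> Gamma) w z : global_section s -> circle z ->
  (tr_section s (inherent_act w z)).2 = (tr_section s w).2 * z.
Proof. by move=> sP cz; rewrite !tr_sectionE // triv_act // proj_act // mulrAC. Qed.

(* For [n = 0] there is no unitary [U] with [det U ^+ 2 = -1], so [inherent_act]
   takes its default value and [-1] acts trivially. *)
Lemma trivial_dim_gt0 (w : Gamma) : (0 < n)%N.
Proof.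
rewrite lt0n; apply/negP => /eqP n0.
have cN1 : circle (-1 : R[i]) by rewrite /circle /= normrN normr1.
have actN1 : inherent_act w (-1) = w.
  rewrite /inherent_act; case: xgetP => // w' -> [f [f' [U [_ _ _ dU _]]]].
  have U1 : \det U = 1 by clear -n0; case: n U n0 => // U _; rewrite det_mx00.
  by move: dU => /eqP; rewrite U1 expr1n -subr_eq0 opprK -mulr2n mulrn_eq0 oner_eq0.
have := triv_act w cN1; rewrite actN1 mulrN1 => /eqP.
rewrite -subr_eq0 opprK -mulr2n mulrn_eq0 /=.
by apply/negP/circle_neq0/triv_circle.
Qed.

End Trivialization.

(** * Algebra and continuity of the lifted action *)

Section LiftedAction.
Context {R : realType} {n : nat} {M : manifold R (n + n)}.
Variables (om : symplectic_form M) (J J' : M -> 'M[R]_(n + n)).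
Variables (Phi : symplectic_circle_action om) (Psi : ufr om J' -> ufr om J).
Variable L : R[i] -> maslov_bundle om J -> maslov_bundle om J.
Hypothesis n_gt0 : (0 < n)%N.
Hypothesis J_compatible : compatible om J.
Hypothesis J'_compatible : compatible om J'.
Hypothesis J'_invariant : invariant_acs Phi J'.
Hypothesis Psi_iso : principal_iso Psi.
Hypothesis L_Psi : forall z (f f' : ufr om J'), circle z ->
  set_val f' = fpush (Phi z) (set_val f) ->
  L z (frame_class (Psi f)) = frame_class (Psi f').
Implicit Types (w : maslov_bundle om J) (z : R[i]).

(** Invariance of [omega] and of [J'] makes the differential of [Phi z] commute with [J'] and
    preserve the metric built from the two. *)
Lemma fpush_unitary z (F : frames M) : circle z ->
  unitary_frame om J' F -> unitary_frame om J' (fpush (Phi z) F).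
Proof.
case: F => p F cz /(unitary_frameE J'_compatible)[vE GF].
apply/(unitary_frameE J'_compatible) => /=.
set d := dmap (Phi z) p; have dJ : d *m J' p = J' (Phi z p) *m d := J'_invariant p cz.
have dom : d^T *m (omega om (Phi z p) : 'M[R]_(n + n)) *m d = omega om p.
  exact: phi_symplectic.
have dg : d^T *m gram om J' (Phi z p) *m d = gram om J' p.
  by rewrite gramE mulmxA -trmx_mul -dJ trmx_mul -!mulmxA (mulmxA d^T) dom.
split.
  have hE : d *m F = row_mx (d *m lsubmx F) (d *m rsubmx F).
    by rewrite -mul_mx_row hsubmxK.
  by rewrite hE row_mxKr row_mxKl vE mulmxN !mulmxA dJ.
move: (gram om J' (Phi z p)) dg => g dg; rewrite trmx_mul.
have -> : F^T *m d^T *m g *m (d *m F) = F^T *m (d^T *m g *m d) *m F by rewrite !mulmxA.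
by rewrite dg.
Qed.

(** The condition on [z] stands under the existential so that [choice] yields a total
    push-forward. *)
Lemma ufr_push_ex z (f : ufr om J') : exists f' : ufr om J',
  circle z -> set_val f' = fpush (Phi z) (set_val f).
Proof.
have [cz|ncz] := pselect (circle z); last by exists f.
have [f' f'E] := ufr_ex (fpush_unitary cz (ufrP f)).
by exists f'.
Qed.

Lemma class_Psi_surj w : exists f, frame_class (Psi f) = w.
Proof.
have [_ [Psi' _ [_ PsiK]] _ _] := Psi_iso.
by have [f <-] := frame_class_surj w; exists (Psi' f); rewrite PsiK.
Qed.

Lemma proj_lift z w : circle z -> bundle_proj (L z w) = Phi z (bundle_proj w).
Proof.
move=> cz; have [_ _ PsiB _] := Psi_iso.
have [f <-] := class_Psi_surj w; have [f' /(_ cz) ff'] := ufr_push_ex z f.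
by rewrite (L_Psi cz ff') !bundle_proj_class !PsiB /ufr_base ff'.
Qed.

Lemma liftM z z' w : circle z -> circle z' -> L (z * z') w = L z (L z' w).
Proof.
move=> cz cz'; have czz' := circleM cz cz'.
have [f <-] := class_Psi_surj w; have [f1 /(_ cz') ff1] := ufr_push_ex z' f.
have [f2 /(_ cz) f1f2] := ufr_push_ex z f1.
have ff2 : set_val f2 = fpush (Phi (z * z')) (set_val f).
  apply: etrans f1f2 _; rewrite ff1; case: (set_val f) => p F.
  have pE : Phi (z * z') p = Phi z (Phi z' p) by exact: phiM.
  congr pair; first by rewrite pE.
  apply: etrans (mulmxA _ _ _) _; congr mulmx.
  exact: (esym (dmap_action Phi p cz cz')).
apply: etrans (L_Psi czz' ff2) _.
by apply: esym; apply: etrans (congr1 (L z) (L_Psi cz' ff1)) _; exact: L_Psi.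
Qed.

(** The differential multiplies a frame matrix on the left and the unitary group on the right, so
    the two actions commute by associativity; [half_rotation] supplies a unitary matrix realizing
    [zeta]. *)
Lemma lift_act z zeta w : circle z -> circle zeta ->
  L z (inherent_act w zeta) = inherent_act (L z w) zeta.
Proof.
move=> cz czeta; have [_ _ _ Psi_mul] := Psi_iso.
have [u ->] := circle_cis_surj czeta.
have uU := @half_rotation_unitary R n u; have dU := half_rotation_det u n_gt0.
have [f <-] := class_Psi_surj w.
have [fU ffU] := ufr_mul_ex J'_compatible f uU.
have [f' /(_ cz) ff'] := ufr_push_ex z f.
have [fU' /(_ cz) fUfU'] := ufr_push_ex z fU.
rewrite (inherent_actE uU dU (Psi_mul _ _ _ uU ffU)) (L_Psi cz ff') (L_Psi cz fUfU').
apply: esym; apply: (inherent_actE uU dU); apply: Psi_mul => //.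
by rewrite /ufr_mul fUfU' ff' ffU /fpush /fmul /= mulmxA.
Qed.

(* [frame_class] and [Psi] are open, so continuity can be tested on frames. *)
Lemma lift_continuous :
  continuous (fun tw : R * maslov_bundle om J => L (cis tw.1) tw.2).
Proof.
have [Psi_c [Psi' Psi'_c [PsiK' PsiK]] _ _] := Psi_iso.
have [push pushP] := choice (fun tf : R * ufr om J' => ufr_push_ex (cis tf.1) tf.2).
have push_c : continuous push.
  apply: (@continuous_comp_initial _ _ _ set_val push).
  have -> : set_val \o push = (fun tF : R * frames M => fpush (Phi (cis tF.1)) tF.2) \o
      (fun tf : R * ufr om J' => (tf.1, set_val tf.2)).
    by apply/funext => tf; apply: pushP; exact: circle_cis.
  move=> tf; apply: continuous_comp; last exact: fpush_action_continuous.
  apply: continuous_at_pair; first exact: cvg_fst.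
  apply: (@continuous_comp _ _ _ snd set_val); first exact: cvg_snd.
  exact: initial_continuous.
have lift_c : continuous (fun tf => frame_class (Psi (push tf))).
  move=> tf; apply: (@continuous_comp _ _ _ push (fun f => frame_class (Psi f))).
    exact: push_c.
  by apply: continuous_comp; [exact: Psi_c|exact: frame_class_continuous].
move=> [t w] A; have [f fw] := class_Psi_surj w.
have LE s g : L (cis s) (frame_class (Psi g)) = frame_class (Psi (push (s, g))).
  by apply: L_Psi; [exact: circle_cis|exact: (pushP (s, g) (circle_cis _))].
rewrite /= -fw LE => /(lift_c (t, f)) [[B C] /= [tB fC] BC].
move: fC; rewrite nbhsE => -[C0 [oC0 C0f] C0C].
pose D := @frame_class R n M om J @` (Psi' @^-1` C0).
have oD : open D.
  by apply: frame_class_open => //; apply: open_comp => // g _; exact: Psi'_c.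
exists (B, D) => /=.
  split=> //; apply: open_nbhs_nbhs; split => //=; exists (Psi f) => //.
  by rewrite /= PsiK'.
move=> [s w'] /= [Bs [g C0g <-]]; rewrite -(PsiK g) LE.
by apply: BC; split => //=; exact: C0C.
Qed.

End LiftedAction.

(** * The local Maslov index *)

Section Velocity.
Context {R : realType} {X : Type}.
Variable C : set (X -> R).

Lemma velocity_derivation (gamma : R -> X) t :
  (forall F, C F -> derivable (F \o gamma) t 1) ->
  derivation C (gamma t) (velocity gamma t).
Proof.
move=> dC; split => [F G a CF CG|F G CF CG]; rewrite /velocity !derive1E.
  rewrite (_ : _ \o gamma = a *: (F \o gamma) + (G \o gamma)) //.
  rewrite deriveD; [|by apply: derivableZ; exact: dC|exact: dC].
  by rewrite deriveZ //; exact: dC.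
rewrite (_ : _ \o gamma = (F \o gamma) * (G \o gamma)) //.
rewrite deriveM; [|exact: dC|exact: dC].
by rewrite addrC; congr (_ + _); rewrite [LHS]mulrC.
Qed.

(** The summand 0 stands for the zero derivation: it puts the multiple into the shape
    [a * D F + D' F] of [one_form_linear]. *)
Lemma derivation_scale w D (a : R) : derivation C w D ->
  derivation C w (fun F => a * D F + 0).
Proof.
move=> [Dlin DM]; split => [F G b CF CG|F G CF CG].
  by rewrite Dlin //; ring.
by rewrite DM //; ring.
Qed.

Lemma one_form_scale alpha w D (a : R) : one_form C alpha -> derivation C w D ->
  alpha w (fun F => a * D F + 0) = a * alpha w D.
Proof.
move=> alphaP DP; pose D0 : (X -> R) -> R := fun=> 0.
have D0P : derivation C w D0.
  by split => [F G b _ _|F G _ _]; rewrite /D0; ring.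
(* Linearity with [a = 1] on two copies of [D0] gives [alpha w D0 = 2 * alpha w D0]. *)
have alpha0 : alpha w D0 = 0.
  have := one_form_linear alphaP 1 D0P D0P.
  rewrite (_ : (fun _ => _) = D0); last by apply/funext => F; rewrite /D0; ring.
  lra.
by have := one_form_linear alphaP a DP D0P; rewrite alpha0 addr0.
Qed.

End Velocity.

Section InherentCurves.
Context {R : realType} {n : nat} {M : manifold R (n + n)}.
Variables (om : symplectic_form M) (J : M -> 'M[R]_(n + n)).
Hypothesis n_gt0 : (0 < n)%N.
Hypothesis J_compatible : compatible om J.
Local Notation Gamma := (maslov_bundle om J).
Implicit Types (w : Gamma).

(** The orbit lifts to the frames [f0] times [half_rotation u], whose coordinates [kappa] have a
    fixed base point and a trigonometric matrix part. Near 0 the function is [G \o kappa] with [G]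
    smooth. *)
Lemma inherent_act_derivable (F : Gamma -> R) w : bundle_smooth F ->
  derivable (fun u : R => F (inherent_act w (cis u))) 0 1.
Proof.
move=> FC; have [f0 <-] := frame_class_surj w.
have [f fP] := choice (fun u : R => ufr_mul_ex J_compatible f0 (half_rotation_unitary u)).
have actE u : inherent_act (frame_class f0) (cis u) = frame_class (f u).
  exact: (inherent_actE (half_rotation_unitary u) (half_rotation_det u n_gt0) (fP u)).
set p := ufr_base f0; set c := chart_at p; have cp : cdom c p := chart_at_dom p.
have [V [G [oV Vf0 sG GE]]] := FC f0; rewrite -/p -/c in Vf0 GE.
have [X0 [X1 [X2 XE]]] := @half_rotation_realify R n.
set F0 := to_chart c p *m (set_val f0).2.
pose kappa (u : R) : 'cV[R]_(n + n) * 'M[R]_(n + n) :=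
  (cmap c p, F0 *m X0 + (cos (pi * u) *: (F0 *m X1) + sin (pi * u) *: (F0 *m X2))).
have kappaE u : fcoord c (set_val (f u)) = kappa u.
  rewrite /fcoord (fP u) /fmul /kappa; congr pair.
  by rewrite XE mulmxA -/F0 -addrA !mulmxDr -!scalemxAr.
have f00 : f 0 = f0.
  apply: ufr_inj; rewrite (fP 0) /fmul (_ : half_rotation 0 = 1%:M).
    by rewrite realify1 mulmx1; case: (set_val f0).
  rewrite /half_rotation -diag_const_mx; congr diag_mx; apply/rowP => j.
  by rewrite !mxE mul0r cis0; case: ifP.
have dpi : differentiable (fun u : R => pi * u) 0.
  by apply/derivable1_diffP; apply: derivableM.
have dcos : differentiable (fun u : R => cos (pi * u)) 0.
  apply: (@differentiable_comp _ _ _ _ (fun u : R => pi * u) (@cos R)) => //.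
  by apply/derivable1_diffP.
have dsin : differentiable (fun u : R => sin (pi * u)) 0.
  apply: (@differentiable_comp _ _ _ _ (fun u : R => pi * u) (@sin R)) => //.
  by apply/derivable1_diffP.
have dkappa : differentiable kappa 0.
  apply: differentiable_pair; first exact: differentiable_cst.
  apply: differentiableD; first exact: differentiable_cst.
  by apply: differentiableD; exact: differentiableZl.
have Vkappa0 : V (kappa 0) by rewrite -kappaE f00.
have dG : differentiable (G \o kappa) 0.
  apply: differentiable_comp => //; exact: smooth_on_differentiable sG Vkappa0.
have nV : \forall u \near (0 : R), V (kappa u).
  have kc := differentiable_continuous dkappa.
  by apply: (kc V); exact: open_nbhs_nbhs.
apply: (@near_eq_derivable _ _ _ (G \o kappa)); last first.
  exact/derivable1_diffP.
apply: filterS nV => u Vu /=; rewrite actE -kappaE.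
have bf : ufr_base (f u) = p by rewrite /ufr_base (fP u).
by apply: esym; apply: GE; rewrite ?bf // kappaE.
Qed.

End InherentCurves.

Section LocalIndex.
Context {R : realType} {n : nat} {M : manifold R (n + n)}.
Variables (om : symplectic_form M) (J : M -> 'M[R]_(n + n)).
Local Notation Gamma := (maslov_bundle om J).
Variables (T : Gamma -> M * R[i]^o) (S : M * R[i]^o -> Gamma).
Hypothesis TK : forall w, S (T w) = w.
Hypothesis T_equivariant : forall w, [/\ (T w).1 = bundle_proj w, circle (T w).2 &
  forall z : R[i], circle z -> T (inherent_act w z) = ((T w).1, (T w).2 * z)].
Hypothesis n_gt0 : (0 < n)%N.
Hypothesis J_compatible : compatible om J.
Implicit Types (w : Gamma).

Let smooth : set (Gamma -> R) := @bundle_smooth R n M om J.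

Lemma inherent_act1 w : inherent_act w 1 = w.
Proof.
have c1 : circle (1 : R[i]) := circle1.
apply: (triv_inj TK T_equivariant); first by rewrite (proj_act T_equivariant).
by rewrite (triv_act T_equivariant) // mulr1.
Qed.

(** Based at [w'], the curve is the inherent orbit at time [k * (u - t)], so differentiability of
    orbits at 0 and the chain rule suffice. *)
Lemma rotation_curve_is_derive (F : Gamma -> R) w (k t : R) : bundle_smooth F ->
  is_derive t 1 (fun u : R => F (inherent_act w (cis (k * u))))
    (k * fundamental_vector (inherent_act w (cis (k * t))) F).
Proof.
move=> FC; set w' := inherent_act w _.
pose h (v : R) := F (inherent_act w' (cis v)).
have hE u : F (inherent_act w (cis (k * u))) = h (k * (u - t)).
  rewrite /h /w' (inherent_actM TK T_equivariant) -?cisD; [|exact: circle_cis|exact: circle_cis].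
  by congr (F (inherent_act w (cis _))); ring.
have -> : (fun u : R => F (inherent_act w (cis (k * u)))) = h \o (fun u => k * (u - t)).
  by apply/funext => u /=; rewrite hE.
have dlin : is_derive t 1 (fun u : R => k * (u - t)) k.
  by apply: is_derive_eq; rewrite subr0 [LHS]mulr1.
have l0 : k * (t - t) = 0 by rewrite subrr mulr0.
have dh : derivable h (k * (t - t)) 1.
  by rewrite l0; exact: inherent_act_derivable.
have dd : differentiable (h \o (fun u => k * (u - t))) t.
  apply: differentiable_comp; first exact/derivable1_diffP/ex_derive.
  exact/derivable1_diffP.
apply: DeriveDef; first exact/derivable1_diffP.
rewrite -derive1E (derive1_comp (@ex_derive _ _ _ _ _ _ _ dlin) dh).
by rewrite /= [X in _ * X]derive1E derive_val l0 mulrC.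
Qed.

Lemma rotation_line_integral alpha w (k : R) : connection_form alpha ->
  line_integral alpha (fun t => inherent_act w (cis (k * t))) = k.
Proof.
move=> [alpha1 _ alpha_fund]; rewrite /line_integral.
pose gamma (t : R) := inherent_act w (cis (k * t)).
have vE t : alpha (gamma t) (velocity gamma t) = k.
  have fundP : derivation smooth (gamma t) (fundamental_vector (gamma t)).
    have := @velocity_derivation _ _ smooth (fun u => inherent_act (gamma t) (cis u)) 0.
    by rewrite cis0 inherent_act1; apply => F FC; exact: inherent_act_derivable.
  have velP : derivation smooth (gamma t) (velocity gamma t).
    by apply: velocity_derivation => F FC; have [] := rotation_curve_is_derive w k t FC.
  (* The velocity and [k] times the fundamental vector are compared on smooth functions only, so
     [one_form_ext] is required to identify their values under [alpha]. *)
  rewrite (one_form_ext alpha1 velP (derivation_scale k fundP)).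
    by rewrite (one_form_scale k alpha1 fundP) alpha_fund mulr1.
  move=> F FC; rewrite addr0 /velocity derive1E.
  by have dv := rotation_curve_is_derive w k t FC; rewrite derive_val.
rewrite (_ : (fun t => _) = cst k); last by apply/funext => t; exact: vE.
have mu1 : lebesgue_measure (`[0, 1]%classic : set R) = 1%:E.
  by rewrite lebesgue_measure_itv /= lte_fin ltr01 -EFinD subr0.
rewrite Rintegral_cst //; apply: etrans (congr1 (fun x => k * fine x) mu1) _.
by rewrite /= mulr1.
Qed.

End LocalIndex.

(** * Degrees of rotated loops and the conclusion *)

Lemma has_degree_mulr (R : realType) (g h : R[i] -> R[i]) (zeta : R[i]) (d : int) :
  circle zeta -> (forall t : R, h (cis t) = g (cis t) * zeta) ->
  has_degree g d -> has_degree h d.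
Proof.
move=> /circle_cis_surj[a ->] hE [th [thc gth thd]].
exists (fun t => th t + a); split.
- by move=> t; apply: cvgD; [exact: thc|exact: cvg_cst].
- by move=> t; rewrite hE gth cisD.
- by rewrite opprD addrACA subrr addr0.
Qed.

Lemma has_degree_rotation (R : realType) (g : R[i] -> R[i]) (zeta : R[i]) (d : int) :
  circle zeta -> (forall t : R, g (cis t) = zeta * cis (d%:~R * t)) -> has_degree g d.
Proof.
move=> cz gE; apply: (@has_degree_mulr _ (fun z => g z * conjc zeta) _ zeta) => //.
  by move=> t; rewrite -mulrA [conjc _ * _]mulrC circle_mulJ ?mulr1.
exists (fun t => d%:~R * t); split.
- by move=> t; apply: cvgM; [exact: cvg_cst|exact: cvg_id].
- by move=> t; rewrite gE mulrAC circle_mulJ ?mul1r.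
- by rewrite mulr1 mulr0 subr0.
Qed.

Theorem proposition31 (R : realType) (n : nat) (M : manifold R (n + n))
    (om : symplectic_form M) (J : M -> 'M[R]_(n + n))
    (M_connected : connected [set: M])
    (J_compatible : compatible om J)
    (Gamma_trivial : trivial_bundle om J)
    (Phi : symplectic_circle_action om)
    (Phi_has_fixed_point : exists p, fixed_point Phi p)
    (L : R[i] -> maslov_bundle om J -> maslov_bundle om J)
    (L_lifted : lifted_action Phi L) :
  exists m : int,
    (forall s, global_section s -> is_maslov_index L s m) /\
    (forall p, fixed_point Phi p -> is_local_maslov_index L p m%:~R).
Proof.
have [T [S [Tc Sc TK SK TP]]] := Gamma_trivial.
have [J' [Psi [cJ' invJ' isoPsi LPsi]]] := L_lifted.
have [p0 fix0] := Phi_has_fixed_point.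
have n0 : (0 < n)%N := trivial_dim_gt0 TP (S (p0, 1)).
pose s0 (p : M) := S (p, 1).
have s0_section : global_section s0.
  split=> [p|p]; last by rewrite -(triv_base TP) SK //; exact: circle1.
  (* [S] is continuous only within the pairs whose second entry lies on the circle; [q |-> (q, 1)]
     stays among them. *)
  have /subspace_continuousP/(_ (p, 1) circle1) Sp := Sc.
  apply: (@cvg_comp _ _ _ (fun q : M => (q, 1 : R[i]^o)) S (nbhs p) _ _ _ Sp) => B /= pB.
  have ip : {for p, continuous (fun q : M => (q, 1 : R[i]^o))}.
    by apply: continuous_at_pair; [exact: cvg_id|exact: cvg_cst].
  by apply: (@filterS _ (nbhs p) _ _ _ _ (ip _ pB)) => q; apply; exact: circle1.
have Lc := lift_continuous J_compatible cJ' invJ' isoPsi LPsi.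
have L_act z zeta w : circle z -> circle zeta ->
    L z (inherent_act w zeta) = inherent_act (L z w) zeta.
  exact: (lift_act n0 cJ' invJ' isoPsi LPsi).
have fixed_rotation p : fixed_point Phi p -> exists m : int, forall w,
    bundle_proj w = p -> forall t, L (cis t) w = inherent_act w (cis (m%:~R * t)).
  move=> fixp; set w0 := s0 p; have pw0 : bundle_proj w0 = p by have [_ ->] := s0_section.
  pose chi (t : R) := (T (L (cis t) w0)).2 * conjc (T w0).2.
  have cchi t : circle (chi t).
    by apply: circleM; [|apply: circleJ]; exact: (triv_circle TP).
  have Lchi t : L (cis t) w0 = inherent_act w0 (chi t).
    apply: (fibre_act TK TP).
    rewrite (proj_lift cJ' invJ' isoPsi LPsi) ?pw0; last exact: circle_cis.
    by rewrite fixp //; exact: circle_cis.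
  have chiD s t : chi (s + t) = chi s * chi t.
    rewrite {1}/chi cisD (liftM cJ' invJ' isoPsi LPsi); [|exact: circle_cis|exact: circle_cis].
    rewrite Lchi L_act //; last exact: circle_cis.
    by rewrite (triv_act TP) // mulrAC.
  have chi_c : ccontinuous chi.
    apply: ccontinuousM; last exact: ccontinuous_cst.
    apply: (ccontinuous_comp (h := fun t : R => L (cis t) w0) _ (triv_angle_continuous Tc)) => t.
    apply: (@continuous_comp _ _ _ (fun t : R => (t, w0)) (fun tw => L (cis tw.1) tw.2)).
      by apply: continuous_at_pair; [exact: cvg_id|exact: cvg_cst].
    exact: Lc.
  have chi1 : chi 1 = 1.
    have chi10 : chi 1 = chi 0 by rewrite /chi cis1 cis0.
    by apply: (mulfI (circle_neq0 (cchi 0))); rewrite {1}chi10 -chiD addr0 mulr1.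
  have [m chiE] := circle_hom chi_c cchi chiD chi1.
  (* [chi] was built from [w0] alone; any other point of the fibre is [w0] moved by the inherent
     action, which commutes with [L], so the same [m] serves it. *)
  exists m => w pw t; have pww0 : bundle_proj w0 = bundle_proj w by rewrite pw.
  have cz : circle ((T w).2 * conjc (T w0).2).
    by apply: circleM; [|apply: circleJ]; exact: (triv_circle TP).
  rewrite (fibre_act TK TP pww0) L_act //; last exact: circle_cis.
  rewrite Lchi chiE !(inherent_actM TK TP) //; [|exact: circle_cis|exact: circle_cis].
  by rewrite mulrC.
have fixed_degree p m s : global_section s -> (forall w,
    bundle_proj w = p -> forall t, L (cis t) w = inherent_act w (cis (m%:~R * t))) ->
    has_degree (fun z => (tr_section s (L z (s p))).2) m.
  move=> sP mP; apply: (has_degree_rotation (tr_section_circle TK TP (s p) sP)) => t.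
  rewrite mP; last by have [_ ->] := sP.
  by rewrite (tr_section_act TK TP) //; exact: circle_cis.
have [m mP] := fixed_rotation p0 fix0.
have degree_m s p : global_section s -> has_degree (fun z => (tr_section s (L z (s p))).2) m.
  move=> sP; have [sc sproj] := sP.
  apply: (has_degree_connected (g := fun p z => (tr_section s (L z (s p))).2)) => //.
  - apply: (ccontinuous_comp (h := fun tx : R * M => L (cis tx.1) (s tx.2)) _
      (tr_section_continuous Tc TK TP sP)) => tx.
    apply: (@continuous_comp _ _ _ (fun tx : R * M => (tx.1, s tx.2))
      (fun tw => L (cis tw.1) tw.2)).
      apply: continuous_at_pair; first exact: cvg_fst.
      by apply: continuous_comp; [exact: cvg_snd|exact: sc].
    exact: Lc.
  - by move=> x t; exact: (tr_section_circle TK TP).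
  - by exists p0; exact: fixed_degree.
exists m; split=> [s sP w|p fixp alpha w alphaP pw].
  have [_ sproj] := sP; set p := bundle_proj w.
  have psw : bundle_proj (s p) = bundle_proj w by rewrite sproj.
  (* The degree is known for loops starting on the section. Starting at [w] multiplies such a loop
     by this constant of the circle, which leaves the degree unchanged. *)
  have cz : circle ((T w).2 * conjc (T (s p)).2).
    by apply: circleM; [|apply: circleJ]; exact: (triv_circle TP).
  apply: (has_degree_mulr cz _ (degree_m s p sP)) => t.
  rewrite {1}(fibre_act TK TP psw) L_act //; last exact: circle_cis.
  by rewrite (tr_section_act TK TP).
(* [m] stems from [p0] and [mp] from [p]. The loop at [s0 p] has degree [m] by connectedness and
   [mp] by direct computation, which identifies the two. *)
have [mp mpP] := fixed_rotation p fixp.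
have -> : m = mp := degree_unique (degree_m s0 p s0_section) (fixed_degree p mp s0 s0_section mpP).
rewrite (_ : (fun t => L (cis t) w) = (fun t => inherent_act w (cis (mp%:~R * t)))).
  exact: (rotation_line_integral TK TP).
by apply/funext => t; exact: mpP.
Qed.
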